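(* Let $d\ge 2$ be an integer. For every real $q>0$ there exists a constant $A_q>0$ depending on $q$ and $d$ only such that the following holds. Let $n\ge 1$ be an integer, let $K$ be a convex body in $\mathbb R^d$ with $K\subseteq B_d$, let $f$ be a probability density (with respect to Lebesgue measure) supported on $K$ with $f\le M$ almost everywhere for some positive number $M$, let $X_1,\dots,X_n$ be i.i.d. random points with density $f$, and let $\hat K_n$ be their convex hull. Then $$\mathbb E_f\left[d_f(K,\hat K_n)^q\right]\le A_q(M+1)^q n^{-2q/(d+1)}.$$
   Context: A convex body in $\mathbb R^d$ is a compact convex set with nonempty interior. $B_d$ is the closed unit Euclidean ball of $\mathbb R^d$ centered at $0$. $\mathbb E_f$ denotes expectation when $X_1,\dots,X_n$ are i.i.d. with density $f$. That $f$ is supported on $K$ means that $f=0$ outside $K$. The weighted missing volume is $d_f(K,\hat K_n)=\int_{K\setminus\hat K_n}f(x)\,dx$. *)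

(* Defs.v *)
From HB Require Import structures.
From mathcomp Require Import all_boot all_order all_algebra.
From mathcomp Require Import all_classical all_reals all_analysis.
From mathcomp Require Import measurable_realfun.

Set Implicit Arguments.
Unset Strict Implicit.
Unset Printing Implicit Defensive.

Import Order.TTheory GRing.Theory Num.Theory.
Import numFieldNormedType.Exports.

Local Open Scope classical_set_scope.
Local Open Scope ring_scope.

(* Row vectors of size d are R^d, with their Borel sigma-algebra. *)
Section borel_rV.
Variables (R : realType) (d : nat).

HB.instance Definition _ := @isMeasurable.Build (sigma_display (@open 'rV[R]_d))
  'rV[R]_d <<s @open 'rV[R]_d >>
  (@sigma_algebra0 _ setT (@open 'rV[R]_d))
  (@sigma_algebraC _ (@open 'rV[R]_d))
  (@sigma_algebra_bigcup _ setT (@open 'rV[R]_d)).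

End borel_rV.

Section lebesgue_tuple_step.
Variables (R : realType) (n : nat).
Variable mu : {sigma_finite_measure set n.-tuple (measurableTypeR R) -> \bar R}.

Definition tcons (p : measurableTypeR R * n.-tuple (measurableTypeR R)) :
  n.+1.-tuple (measurableTypeR R) := [tuple of p.1 :: p.2].

Lemma measurable_tcons : measurable_fun setT tcons.
Proof. exact: measurable_cons. Qed.

Definition lebesgue_cons : set (n.+1.-tuple (measurableTypeR R)) -> \bar R :=
  pushforward (@lebesgue_measure R \x mu)%E tcons.

Let pm := @measure_function_pushforward__canonical__measure_function_Measure
  _ _ _ _ R (@lebesgue_measure R \x mu)%E tcons measurable_tcons.

Let cons0 : lebesgue_cons set0 = 0%E.
Proof. exact: (measure0 pm). Qed.

Let cons_ge0 A : (0 <= lebesgue_cons A)%E.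
Proof. exact: (measure_ge0 pm). Qed.

Let cons_sigma_additive : semi_sigma_additive lebesgue_cons.
Proof. exact: (@measure_semi_sigma_additive _ _ _ pm). Qed.

HB.instance Definition _ := isMeasure.Build _ _ _ lebesgue_cons
  cons0 cons_ge0 cons_sigma_additive.

Lemma lebesgue_consE (A : set R) (B : set (n.-tuple (measurableTypeR R))) :
  measurable A -> measurable B ->
  lebesgue_cons [set t | A (thead t) /\ B [tuple of behead t]] =
  (lebesgue_measure A * mu B)%E.
Proof.
move=> mA mB; rewrite -product_measure1E// /lebesgue_cons /pushforward.
congr (product_measure1 _ _ _); apply/seteqP.
have tE (t : n.-tuple (measurableTypeR R)) x : [tuple of behead [tuple of x :: t]] = t.
  by apply: val_inj.
by split=> -[x t] /=; rewrite theadE tE.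
Qed.

Let cons_sigma_finite : sigma_finite setT lebesgue_cons.
Proof.
have /sigma_finiteP[F [TF ndF Foo]] := sigma_finiteT (@lebesgue_measure R).
have /sigma_finiteP[G [TG ndG Goo]] := sigma_finiteT mu.
exists (fun k => [set t | F k (thead t) /\ G k [tuple of behead t]]).
  apply/esym/seteqP; split=> // t _.
  have [i _ Fi] : (\bigcup_i F i) (thead t) by rewrite -TF.
  have [j _ Gj] : (\bigcup_i G i) [tuple of behead t] by rewrite -TG.
  exists (maxn i j) => //; split.
  - by move: Fi; exact/subsetPset/ndF/leq_maxl.
  - by move: Gj; exact/subsetPset/ndG/leq_maxr.
move=> k; have [mF Fk] := Foo k; have [mG Gk] := Goo k; split; last first.
  by rewrite lebesgue_consE// lte_mul_pinfty// ge0_fin_numE.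
apply: measurableI.
- rewrite -[X in measurable X]setTI.
  exact: (@measurable_tnth _ _ _ ord0).
- rewrite -[X in measurable X]setTI.
  exact: (@measurable_behead _ (measurableTypeR R)).
Qed.

HB.instance Definition _ := Measure_isSigmaFinite.Build _ _ _ lebesgue_cons
  cons_sigma_finite.

End lebesgue_tuple_step.

(* Iterated product of the one-dimensional Lebesgue measure; the step pushes
   lebesgue_measure \x mu forward along the cons of tuples. *)
Fixpoint lebesgue_tuple (R : realType) (n : nat) :
  {sigma_finite_measure set n.-tuple (measurableTypeR R) -> \bar R} :=
  match n with
  | 0 => [the sigma_finite_measure _ _ of @dirac _ _ [tuple] R]
  | n'.+1 => [the sigma_finite_measure _ _ of lebesgue_cons (lebesgue_tuple R n')]
  end.

Definition row_of_tuple (R : realType) (n : nat)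
  (t : n.-tuple (measurableTypeR R)) : 'rV[R]_n := \row_(i < n) tnth t i.

Lemma measurable_box (R : realType) (n : nat) (A : 'I_n -> set R) :
  (forall i, measurable (A i)) ->
  measurable [set t : n.-tuple (measurableTypeR R) | forall i, A i (tnth t i)].
Proof.
move=> mA.
rewrite (_ : mkset _ = \bigcap_(i in [set: 'I_n])
    ((fun t : n.-tuple (measurableTypeR R) => tnth t i) @^-1` A i)); last first.
  by apply/seteqP; split=> t /= tA i; [move=> _|]; exact: tA.
apply: fin_bigcap_measurable => [|i _]; first exact: finite_finset.
rewrite -[X in measurable X]setTI.
by apply: (@measurable_tnth _ (measurableTypeR R)) => //; exact: mA.
Qed.

Lemma lebesgue_tuple_box (R : realType) (n : nat) (A : 'I_n -> set R) :
  (forall i, measurable (A i)) ->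
  lebesgue_tuple R n [set t | forall i, A i (tnth t i)] =
  (\prod_(i < n) lebesgue_measure (A i))%E.
Proof.
elim: n A => [|n IH] A mA.
  rewrite big_ord0 /= diracE mem_set//.
  by case.
rewrite big_ord_recl -IH//.
have mB := measurable_box (fun i => mA (lift ord0 i)).
rewrite -(lebesgue_consE _ (mA ord0) mB) /=.
congr (lebesgue_cons _ _); apply/seteqP; split=> t; case/tupleP: t => x t /=;
  rewrite theadE (_ : [tuple of behead [tuple of x :: t]] = t :> n.-tuple _);
  try exact: val_inj.
- move=> tA; split=> [|i]; first exact: (tA ord0).
  by rewrite -(tnthS x); exact: tA.
- move=> [A0 AS] i; case: (unliftP ord0 i) => [j ->|->]; last exact: A0.
  by rewrite tnthS; exact: AS.
Qed.

Lemma measurable_row_of_tuple (R : realType) (n : nat) :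
  measurable_fun setT (@row_of_tuple R n).
Proof.
apply: (@measurability _ _ _ _ _ _ (@open 'rV[R]_n)) => // _ [U oU <-].
rewrite setTI.
pose box (p : 'rV[rat]_n * nat) := [set x : 'rV[R]_n |
  forall i, `|x ord0 i - ratr (p.1 ord0 i)| < p.2.+1%:R^-1].
pose F p := if `[< box p `<=` U >] then @row_of_tuple R n @^-1` box p else set0.
rewrite (_ : _ @^-1` U = \bigcup_p F p); last first.
  apply/seteqP; split=> t /=; last first.
    by move=> [p _]; rewrite /F; case: asboolP => // + ?; exact.
  move=> Ut; have /nbhs_ballP[e /= e0 eU] := open_nbhs_nbhs (conj oU Ut).
  have [k ke] : exists k, (k.+1%:R^-1 : R) < e / 2.
    have [k _ /(_ k (leqnn _))] := near_infty_natSinv_lt (PosNum (divr_gt0 e0 (ltr0n R 2))).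
    by exists k.
  have /choice[q qP] : forall i, exists q : rat,
      `|row_of_tuple t ord0 i - ratr q| < k.+1%:R^-1.
    move=> i; have [|q] := @rat_in_itvoo R (row_of_tuple t ord0 i)
      (row_of_tuple t ord0 i + k.+1%:R^-1).
      by rewrite ltrDl.
    rewrite in_itv/= => /andP[q1 q2]; exists q.
    by rewrite distrC gtr0_norm ?subr_gt0// ltrBlDl.
  exists (\row_i q i, k) => //; rewrite /F asboolT => [|x xq].
    by move=> i; rewrite [X in ratr X]mxE; exact: qP.
  apply: eU; split=> // i j; rewrite (ord1 i) /ball/=.
  have /= := xq j; rewrite [X in ratr X]mxE => xj.
  rewrite -[ltLHS]/(`|row_of_tuple t ord0 j - x ord0 j|).
  rewrite (le_lt_trans (ler_distD (ratr (q j)) _ _))// (splitr e) ltrD//.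
    exact: lt_trans (qP j) ke.
  by rewrite distrC (lt_trans xj).
apply: countable_bigcupT_measurable => [|p]; first exact: countableP.
rewrite /F; case: asboolP => // _.
rewrite (_ : _ @^-1` _ = [set t : n.-tuple (measurableTypeR R) |
   forall i, (ball (ratr (p.1 ord0 i) : R) p.2.+1%:R^-1) (tnth t i)]).
  apply: (@measurable_box _ _ (fun i => ball (ratr (p.1 ord0 i) : R) _)) => i.
  by apply: open_measurable; exact: ball_open.
apply/seteqP; split=> t /= + i => /(_ i).
  by rewrite mxE -ball_normE /= distrC.
by rewrite mxE -ball_normE /= distrC.
Qed.

(* Lebesgue measure on the Borel sets of R^d; lebesgue_rV_box is its
   characteristic property. *)
Section lebesgue_rV.
Variables (R : realType) (d : nat).

Definition lebesgue_rV : set 'rV[R]_d -> \bar R :=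
  pushforward (lebesgue_tuple R d) (@row_of_tuple R d).

Let pm := @measure_function_pushforward__canonical__measure_function_Measure
  _ _ _ _ R (lebesgue_tuple R d) _ (@measurable_row_of_tuple R d).

Let lebesgue_rV0 : lebesgue_rV set0 = 0%E.
Proof. exact: (measure0 pm). Qed.

Let lebesgue_rV_ge0 A : (0 <= lebesgue_rV A)%E.
Proof. exact: (measure_ge0 pm). Qed.

Let lebesgue_rV_sigma_additive : semi_sigma_additive lebesgue_rV.
Proof. exact: (@measure_semi_sigma_additive _ _ _ pm). Qed.

HB.instance Definition _ := isMeasure.Build _ _ _ lebesgue_rV
  lebesgue_rV0 lebesgue_rV_ge0 lebesgue_rV_sigma_additive.

Lemma lebesgue_rV_box (A : 'I_d -> set R) : (forall i, measurable (A i)) ->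
  lebesgue_rV [set x | forall i, A i (x ord0 i)] =
  (\prod_(i < d) lebesgue_measure (A i))%E.
Proof.
move=> mA; rewrite -lebesgue_tuple_box//; congr (lebesgue_tuple R d _).
by apply/seteqP; split=> t /= + i => /(_ i); rewrite mxE.
Qed.

End lebesgue_rV.

(* The library's norm on matrices is the sup norm, hence this definition. *)
Definition euclidean_norm (R : realType) (d : nat) (x : 'rV[R]_d) : R :=
  Num.sqrt (\sum_(i < d) x ord0 i ^+ 2).

Definition unit_ball (R : realType) (d : nat) : set 'rV[R]_d :=
  [set x | euclidean_norm x <= 1].

Definition convex_body (R : realType) (d : nat) (K : set 'rV[R]_d) : Prop :=
  [/\ compact K, convex_set K & K° !=set0].

Definition convex_hull (R : realType) (d : nat) (A : set 'rV[R]_d) :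
  set 'rV[R]_d := smallest (@convex_set R 'rV[R]_d) A.

Definition probability_density (R : realType) (d : nat) (f : 'rV[R]_d -> R) :
  Prop :=
  [/\ measurable_fun setT f, forall x, 0 <= f x
    & (\int[@lebesgue_rV R d]_x (f x)%:E = 1)%E].

Definition has_density (R : realType) (d : nat) (disp : measure_display)
  (T : measurableType disp) (P : probability T R) (X : {RV P >-> 'rV[R]_d})
  (f : 'rV[R]_d -> R) : Prop :=
  forall A, measurable A ->
    distribution P X A = (\int[@lebesgue_rV R d]_(x in A) (f x)%:E)%E.

Definition independent_RVs (R : realType) (disp disp' : measure_display)
  (T : measurableType disp) (T' : measurableType disp') (P : probability T R)
  (I : finType) (X : I -> {RV P >-> T'}) : Prop :=
  forall (J : {set I}) (A : I -> set T'), (forall i, measurable (A i)) ->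
    P (\bigcap_(i in [set` J]) X i @^-1` A i) =
    (\prod_(i in J) P (X i @^-1` A i))%E.

Definition weighted_missing_volume (R : realType) (d : nat)
  (f : 'rV[R]_d -> R) (K L : set 'rV[R]_d) : R :=
  \int[@lebesgue_rV R d]_(x in K `\` L) f x.

(* Main.v *)
Require Import Defs.
From HB Require Import structures.
From mathcomp Require Import all_boot all_order all_algebra.
From mathcomp Require Import all_classical all_reals all_analysis.
From mathcomp Require Import measurable_realfun.
From mathcomp Require Import ring lra.

Set Implicit Arguments.
Unset Strict Implicit.
Unset Printing Implicit Defensive.

Import Order.TTheory GRing.Theory Num.Theory.
Import numFieldNormedType.Exports.

Local Open Scope classical_set_scope.
Local Open Scope ring_scope.

(** Write nu for the common law of the X_i, p for the nu-mass of K minus the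
    hull of the n points, and C for constants depending on d only. The proof
    bounds the mean of p and then gets every moment from independence.

    First moment. The mass nu gives to the complement of the hull of the points
    other than X_i is the conditional probability that X_i falls there, and it
    dominates p. Summing over i, n E[p] is at most the expected number of
    points X_i lying outside the hull of the others. Fix r in (0, 1] and split
    these points according to whether a hyperplane separates X_i from the
    others with margin greater than r^2.

    - With margin r^2 there are at most C r^(1-d) of them, whatever the
      configuration ([separated_vertices_card]). If u_i is the unit normal at
      x_i, the segments x_i + s u_i, 1 <= s <= 2, stay at mutual distance at
      least 2 r, since outward normals of a convex set only spread apart. Each
      segment holds about 1/r points spaced by r, and a bounded region of R^d
      contains at most C r^(-d) points at mutual distance at least r.

    - Without it, X_i lies in a shell around the hull of the others, and such a
      shell has Lebesgue measure at most C r^2 inside a fixed cube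
      ([lebesgue_shell]): sort its points by the largest coordinate of a
      separating direction; moving a point by d r^2 along that axis makes the
      margin exceed r^2, so many translates of each part of the shell are
      disjoint. As nu has density at most M, the probability is at most
      C M r^2.

    Hence n E[p] <= C (r^(1-d) + n M r^2), and r = n^(-1/(d+1)) balances the two
    terms: E[p] <= C (M + 1) n^(-2/(d+1)) ([integral_missing_mass_le_powR]).

    All moments. Let m be an integer above q and cut the sample into m disjoint
    groups of about n/m points. Enlarging the sample can only decrease the
    missing mass, so p is at most the missing mass p_j of each group, whence
    p^m <= p_1 ... p_m, and independence gives E[p^m] <= a^m with a the bound on
    the mean for n/m points ([integral_prod_missing_mass]). Finally
    t^q <= a^q (1 + (t/a)^m) for t >= 0, so that E[p^q] <= 2 a^q.

    Separating directions are taken rational throughout, which makes every event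
    a countable union of measurable ones. The measurability of p itself is never
    established: the integral of a nonnegative function is a supremum over the
    simple functions below it, hence is monotone without any measurability
    ([ge0_le_lower_integral]). *)

(** * Inner products and packing *)

Section dot.
Variables (R : realType) (d : nat).
Implicit Types (u v x y : 'rV[R]_d) (a : R).

Definition dot u x : R := \sum_(c < d) u ord0 c * x ord0 c.

Lemma dotC u x : dot u x = dot x u.
Proof. by apply: eq_bigr => c _; rewrite mulrC. Qed.

Lemma dotDr u x y : dot u (x + y) = dot u x + dot u y.
Proof. by rewrite /dot -big_split; apply: eq_bigr => c _; rewrite mxE mulrDr. Qed.

Lemma dotZr u a x : dot u (a *: x) = a * dot u x.
Proof. by rewrite /dot mulr_sumr; apply: eq_bigr => c _; rewrite mxE mulrCA. Qed.

Lemma dotNr u x : dot u (- x) = - dot u x.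
Proof. by rewrite -scaleN1r dotZr mulN1r. Qed.

Lemma dotBr u x y : dot u (x - y) = dot u x - dot u y.
Proof. by rewrite dotDr dotNr. Qed.

Lemma dotDl u v x : dot (u + v) x = dot u x + dot v x.
Proof. by rewrite dotC dotDr !(dotC x). Qed.

Lemma dotZl a u x : dot (a *: u) x = a * dot u x.
Proof. by rewrite dotC dotZr dotC. Qed.

Lemma dotNl u x : dot (- u) x = - dot u x.
Proof. by rewrite dotC dotNr dotC. Qed.

Lemma dotBl u v x : dot (u - v) x = dot u x - dot v x.
Proof. by rewrite dotDl dotNl. Qed.

Lemma dotxx_ge0 x : 0 <= dot x x.
Proof. by apply: sumr_ge0 => c _; rewrite -expr2 sqr_ge0. Qed.

Lemma sqr_coord_le_dot x c : x ord0 c ^+ 2 <= dot x x.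
Proof.
by rewrite /dot (bigD1 c)//= expr2 lerDl sumr_ge0// => k _; rewrite -expr2 sqr_ge0.
Qed.

Lemma dotxx_eq0 x : (dot x x == 0) = (x == 0).
Proof.
apply/idP/eqP => [|->]; last by rewrite /dot big1// => c _; rewrite mxE mul0r.
move=> /eqP xx0; apply/rowP => c; rewrite mxE; apply/eqP; rewrite -sqrf_eq0.
by rewrite eq_le sqr_ge0 andbT -xx0 sqr_coord_le_dot.
Qed.

Lemma dotxx_gt0 x : x != 0 -> 0 < dot x x.
Proof. by rewrite lt0r dotxx_ge0 andbT dotxx_eq0. Qed.

Lemma euclidean_normE x : euclidean_norm x = Num.sqrt (dot x x).
Proof. by []. Qed.

(** A bound with d in place of the sharp square root of d, which is enough
    wherever only the order of magnitude matters. *)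
Lemma euclidean_norm_le_max_coord x c : (forall k, `|x ord0 k| <= `|x ord0 c|) ->
  euclidean_norm x <= d%:R * `|x ord0 c|.
Proof.
move=> xc; rewrite euclidean_normE.
rewrite -(ger0_norm (mulr_ge0 (ler0n R d) (normr_ge0 (x ord0 c)))).
rewrite -sqrtr_sqr ler_wsqrtr// exprMn (@le_trans _ _ (d%:R * `|x ord0 c| ^+ 2))//.
  rewrite /dot mulr_natl -[X in _ *+ X]card_ord.
  rewrite -sumr_const ler_sum// => k _.
  by rewrite -expr2 -[leLHS]real_normK ?num_real// ler_sqr ?nnegrE.
rewrite ler_wpM2r ?exprn_ge0// expr2 -natrM ler_nat.
by case: (posnP d) => [->//|]; exact: leq_pmulr.
Qed.

End dot.

Section grid.
Variables (R : realType) (d : nat) (S : finType) (z : S -> 'rV[R]_d).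

(** Two points of a half-open cell of side r / d are at distance less than r,
    so a cell of the grid contains at most one of the points. *)
Lemma grid_pigeonhole (r b : R) : (0 < d)%N -> 0 < r ->
    (forall s c, `|z s ord0 c| <= b) ->
    (forall s t, s != t -> r ^+ 2 <= dot (z s - z t) (z s - z t)) ->
  (#|S| <= (Num.trunc (2 * b * d%:R / r)).+1 ^ d)%N.
Proof.
move=> d0 r0 zb zr; set N := Num.trunc _.
have dr0 : 0 < d%:R / r by rewrite divr_gt0// ltr0n.
have cell_ge0 s c : 0 <= (z s ord0 c + b) * (d%:R / r).
  by rewrite mulr_ge0 ?(ltW dr0)//; have := zb s c; rewrite ler_norml; lra.
(* The rescaling by d / r turns cells into unit cubes with integer corners. *)
pose cell s : {ffun 'I_d -> 'I_N.+1} :=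
  [ffun c => inord (Num.trunc ((z s ord0 c + b) * (d%:R / r)))].
have cellE s c : cell s c = Num.trunc ((z s ord0 c + b) * (d%:R / r)) :> nat.
  rewrite ffunE inordK// ltnS le_truncn// -mulrA ler_wpM2r ?(ltW dr0)//.
  by have := zb s c; rewrite ler_norml; lra.
suff /leq_card : injective cell by rewrite card_ffun !card_ord.
move=> s t st; apply/eqP/negPn/negP => /zr; apply/negP; rewrite -ltNge.
have close c : `|z s ord0 c - z t ord0 c| < r / d%:R.
  have := truncn_itv (cell_ge0 s c); have := truncn_itv (cell_ge0 t c).
  rewrite -!cellE st; set p := (_%:R : R); rewrite -natr1 -/p.
  move=> /andP[t1 t2] /andP[s1 s2].
  rewrite -(ltr_pM2r dr0) -[X in _ < X * _]invf_div mulVf ?gt_eqF//.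
  rewrite -{1}(gtr0_norm dr0) -normrM ltr_norml; lra.
rewrite /dot (@lt_le_trans _ _ (\sum_(c < d) (r / d%:R) ^+ 2))//.
  apply: ltr_sum => [|c _]; first by apply/hasP; exists (Ordinal d0).
  rewrite !mxE -expr2 -real_normK ?num_real// ltr_sqr ?nnegrE//.
  by rewrite divr_ge0// ltW.
rewrite sumr_const card_ord -[leLHS]mulr_natl expr_div_n mulrCA ler_piMr ?sqr_ge0//.
rewrite expr2 invfM mulrA divff ?mul1r ?invf_le1 ?ler1n ?ltr0n//.
by rewrite gt_eqF// ltr0n.
Qed.

End grid.

Section packing.
Variables (R : realType) (d : nat).

(** The hypotheses say that u and v are outward normals at x and y. Expanding
    the square gives |x - y|^2 + (s - t)^2 + 2 s t (1 - <u, v>) plus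
    2 s <u, x - y> + 2 t <v, y - x>, and each of the last two terms is at
    least 2 e. *)
Lemma normal_rays_separated (x y u v : 'rV[R]_d) (e s t : R) :
  dot u u = 1 -> dot v v = 1 -> 0 <= e -> 1 <= s -> 1 <= t ->
  e <= dot u (x - y) -> e <= dot v (y - x) ->
  4 * e <= dot (x + s *: u - (y + t *: v)) (x + s *: u - (y + t *: v)).
Proof.
move=> uu vv e0 s1 t1 ue ve.
have uv : 0 <= dot (u - v) (u - v) by exact: dotxx_ge0.
have xy : 0 <= dot (x - y) (x - y) by exact: dotxx_ge0.
move: uv xy ue ve; rewrite !(dotBl, dotBr, dotDl, dotDr, dotZl, dotZr) uu vv.
rewrite (dotC v u) (dotC y x) (dotC v x) (dotC v y) (dotC u x) (dotC u y).
move: (dot x x) (dot y y) (dot x y) (dot u v) (dot x u) (dot y u) (dot x v)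
  (dot y v) => xx yy xy uv xu yu xv yv uv1 xxy h1 h2.
have p1 : 0 <= (s * t) * (1 - uv) by rewrite mulr_ge0 ?mulr_ge0//; lra.
have p2 : 0 <= (s - 1) * e by rewrite mulr_ge0//; lra.
have p3 : 0 <= (t - 1) * e by rewrite mulr_ge0//; lra.
have p4 : 0 <= s * (xu - yu - e) by rewrite mulr_ge0//; lra.
have p5 : 0 <= t * (yv - xv - e) by rewrite mulr_ge0//; lra.
have p6 : 0 <= (s - t) ^+ 2 by exact: sqr_ge0.
nra.
Qed.

(** The exponent d - 1 rather than d comes from counting points on the normal
    segments, one dimension up: each index contributes about 1 / r points that
    are r-separated from all the others. *)
Lemma separated_vertices_card (I : finType) (J : {set I}) (x u : I -> 'rV[R]_d)
    (r : R) : (0 < d)%N -> 0 < r <= 1 ->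
    (forall i c, i \in J -> `|x i ord0 c| <= 1) ->
    (forall i, i \in J -> dot (u i) (u i) = 1) ->
    (forall i j, i \in J -> j \in J -> j != i ->
      r ^+ 2 <= dot (u i) (x i - x j)) ->
  #|J|%:R * r ^+ d.-1 <= (7 * d)%:R ^+ d.
Proof.
move=> d0 /andP[r0 r1] x1 u1 sep.
have r1_ge0 : 0 <= r^-1 by rewrite invr_ge0 ltW.
(* 1 / r < k <= 1 / r + 1: the parameters 1 + a r, a < k, stay within [1, 2]. *)
pose k := (Num.trunc r^-1).+1.
have /andP[kr rk] : ((k.-1%:R : R) <= r^-1 < k%:R) by exact: truncn_itv.
have level (a : 'I_k) : 1 <= 1 + a%:R * r <= 2.
  rewrite lerDl mulr_ge0 ?(ltW r0)//= -lerBrDl -ler_pdivlMr//.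
  have -> : (2 - 1) / r = r^-1 by rewrite -[RHS]mul1r; congr (_ * _); lra.
  by apply: le_trans kr; rewrite ler_nat -ltnS ltn_ord.
pose S := ({i | i \in J} * 'I_k)%type.
pose z (s : S) := x (val s.1) + (1 + s.2%:R * r) *: u (val s.1).
have zb s c : `|z s ord0 c| <= 3.
  rewrite !mxE; apply: (le_trans (ler_normD _ _)).
  have /andP[l1 l2] := level s.2; rewrite normrM.
  have uc : `|u (val s.1) ord0 c| <= 1.
    rewrite -(@ler_sqr _ _ 1) ?nnegrE// real_normK ?num_real// expr1n.
    by rewrite -(u1 _ (valP s.1)); exact: sqr_coord_le_dot.
  have := x1 _ c (valP s.1).
  rewrite (ger0_norm (le_trans ler01 l1)) => xc.
  have : (1 + s.2%:R * r) * `|u (val s.1) ord0 c| <= 2 * 1.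
    by apply: ler_pM => //; lra.
  by lra.
have zr s t : s != t -> r ^+ 2 <= dot (z s - z t) (z s - z t).
  case: s t => [i a] [j b]; have [<-{j}|ij _] := eqVneq i j.
    rewrite xpair_eqE eqxx /= => ab.
    have -> : z (i, a) - z (i, b) = ((a%:R - b%:R) * r) *: u (val i).
      by rewrite /z /= opprD addrACA subrr add0r -scalerBl; congr (_ *: _); ring.
    rewrite dotZl dotZr u1 ?(valP i)// mulr1 -expr2 exprMn ler_peMl ?sqr_ge0//.
    rewrite -real_normK ?num_real// -[leLHS](expr1n _ 2) ler_sqr ?nnegrE//.
    rewrite !pmulrn -intrB -intr_norm -[leLHS]/(1%:~R) ler_int.
    by rewrite -gtz0_ge1 normr_gt0 subr_eq0.
  have /andP[a1 _] := level a; have /andP[b1 _] := level b.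
  apply: (@le_trans _ _ (4 * r ^+ 2)); first by have := sqr_ge0 r; lra.
  apply: normal_rays_separated; rewrite ?u1 ?sqr_ge0 ?(valP i) ?(valP j)//.
    by apply: sep; rewrite ?(valP i) ?(valP j)// eq_sym.
  by apply: sep; rewrite ?(valP i) ?(valP j).
have := grid_pigeonhole d0 r0 zb zr.
rewrite card_prod card_sig card_ord; set N := Num.trunc _ => cardle.
have N7 : (N.+1%:R : R) <= (7 * d)%:R / r.
  have b0 : 0 <= 2 * 3 * d%:R / r :> R by rewrite !mulr_ge0.
  have /andP[N1 _] := truncn_itv b0.
  rewrite -natr1 (le_trans (lerD N1 (lexx _)))// natrM.
  suff : 1 <= d%:R / r by rewrite -!mulrA; lra.
  by rewrite ler_pdivlMr// mul1r (le_trans r1)// ler1n.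
have : (#|J|%:R * k%:R : R) <= ((7 * d)%:R / r) ^+ d.
  apply: le_trans (_ : N.+1%:R ^+ d <= _); last first.
    by rewrite lerXn2r ?nnegrE// (le_trans _ N7).
  by rewrite -natrM -natrX ler_nat.
have Jk : #|J|%:R / r <= #|J|%:R * k%:R by rewrite ler_wpM2l// ltW.
move=> /(le_trans Jk); rewrite expr_div_n ler_pdivlMr ?exprn_gt0//.
apply: le_trans; rewrite -[in leRHS](prednK d0) exprS mulrA.
by rewrite divfK ?gt_eqF.
Qed.

End packing.

(** * Separating a point from a convex hull *)

Section separation.
Variables (R : realType) (d : nat).
Implicit Types (x : 'rV[R]_d) (C : set 'rV[R]_d).

Lemma continuous_bigsum (T : topologicalType) (I : finType) (f : I -> T -> R) :
  (forall i, continuous (f i)) -> continuous (fun t => \sum_i f i t).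
Proof.
move=> cf; rewrite -fct_sumE; elim/big_ind: _ => [|g h cg ch|i _]; last exact: cf.
  exact: cst_continuous.
by move=> t; apply: continuousD; [exact: cg|exact: ch].
Qed.

Lemma continuous_dot (T : topologicalType) (f g : T -> 'rV[R]_d) :
  (forall c, continuous (fun t => f t ord0 c)) ->
  (forall c, continuous (fun t => g t ord0 c)) ->
  continuous (fun t => dot (f t) (g t)).
Proof.
move=> cf cg; apply: continuous_bigsum => c t.
by apply: (@continuousM _ _ (fun t => f t ord0 c) (fun t => g t ord0 c));
  [exact: cf|exact: cg].
Qed.

Definition weighted_sum n (y : 'I_n -> 'rV[R]_d) (l : 'rV[R]_n) : 'rV[R]_d :=
  \sum_j l ord0 j *: y j.

Definition simplex n : set 'rV[R]_n :=
  [set l | (forall j, 0 <= l ord0 j) /\ \sum_j l ord0 j = 1].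

Lemma convex_set_segment C x y (t : R) : @convex_set R 'rV[R]_d C ->
  C x -> C y -> 0 <= t -> t <= 1 -> C (t *: x + (1 - t) *: y).
Proof.
move=> cC Cx Cy t0 t1.
by have := cC x y (Itv01 t0 t1) (mem_set Cx) (mem_set Cy); rewrite inE.
Qed.

(** Induction on the number of points, with unnormalized weights so that the
    partial averages of the induction stay inside C. *)
Lemma convex_set_weighted_sum C : @convex_set R 'rV[R]_d C ->
  forall n (y : 'I_n -> 'rV[R]_d) (l : 'rV[R]_n),
    (forall j, C (y j)) -> simplex l -> C (weighted_sum y l).
Proof.
move=> cC.
suff avg n (y : 'I_n -> 'rV[R]_d) (l : 'I_n -> R) : (forall j, C (y j)) ->
    (forall j, 0 <= l j) -> 0 < \sum_j l j ->
    C ((\sum_j l j)^-1 *: \sum_j l j *: y j).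
  move=> n y l Cy [l0 l1]; have := avg n y (fun j => l ord0 j) Cy l0.
  by rewrite l1 invr1 scale1r; apply.
elim: n => [|n IHn] in y l * => Cy l0; first by rewrite big_ord0 ltxx.
rewrite !big_ord_recr /=; set s := \sum_(i < n) _; set v := \sum_(i < n) _.
move=> sl0; have s0 : 0 <= s by exact: sumr_ge0.
have {}IHn := IHn _ _ (fun j => Cy (widen_ord (leqnSn n) j))
  (fun j => l0 (widen_ord (leqnSn n) j)).
have [sE|sn0] := eqVneq s 0.
  have -> : v = 0.
    rewrite /v big1// => i _; suff -> : l (widen_ord (leqnSn n) i) = 0.
      by rewrite scale0r.
    apply/eqP; move/eqP: sE; rewrite /s psumr_eq0// => /allP/(_ i).
    by rewrite mem_index_enum; exact.
  move: sl0; rewrite sE !add0r => sl0.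
  by rewrite scalerA mulVf ?scale1r// gt_eqF.
have sgt0 : 0 < s by rewrite lt0r sn0.
have le1 : s / (s + l ord_max) <= 1 by rewrite ler_pdivrMr// mul1r lerDl.
have := convex_set_segment cC (IHn sgt0) (Cy ord_max) (divr_ge0 s0 (ltW sl0)) le1.
congr C; rewrite scalerDr !scalerA; congr (_ *: _ + _ *: _).
  by rewrite mulrC mulrA mulVf ?mul1r.
by rewrite -[X in X - _](divff (lt0r_neq0 sl0)) -mulrBl addrAC subrr add0r mulrC.
Qed.

Lemma compact_simplex n : compact (@simplex n).
Proof.
have -> : @simplex n = [set l : 'rV[R]_n | forall j, `[0, 1]%classic (l ord0 j)]
    `&` ((fun l : 'rV[R]_n => \sum_j l ord0 j) @^-1` [set x | x = 1]).
  apply/seteqP; split=> l [l0 l1]; split=> // j; last first.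
    by have := l0 j; rewrite /= in_itv/= => /andP[].
  rewrite /= in_itv/= l0 -l1 (bigD1 j)//= lerDl sumr_ge0//.
apply: compact_closedI.
  have := @rV_compact R n (fun=> `[0, 1]%classic) (fun=> @segment_compact R 0 1).
  exact.
apply: closed_comp => [l _|]; last exact: closed_eq.
by apply: continuous_bigsum => j; exact: coord_continuous.
Qed.

(** The direction points from the nearest point p of the hull to x. The hull is
    the image of the compact simplex, so p exists; moving p slightly towards
    any y j cannot decrease the distance to x, so y j lies on the side of p. *)
Lemma exists_separating_vector n (y : 'I_n -> 'rV[R]_d) x : (0 < n)%N ->
  ~ convex_hull (range y) x -> exists u, forall j, 0 < dot u (x - y j).
Proof.
move=> n0 xNhull.
pose dist2 l := dot (x - weighted_sum y l) (x - weighted_sum y l).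
have cdist2 : continuous dist2.
  suff cc c : continuous (fun l => (x - weighted_sum y l) ord0 c).
    exact: continuous_dot.
  rewrite (_ : (fun _ => _) =
      (fun l : 'rV[R]_n => x ord0 c - \sum_j l ord0 j * y j ord0 c)).
    move=> l; apply: continuousB; first exact: cst_continuous.
    apply: continuous_bigsum => j {}l.
    apply: continuousM; [exact: coord_continuous|exact: cst_continuous].
  apply/funext => l; rewrite !mxE summxE; congr (_ - _).
  by apply: eq_bigr => j _; rewrite mxE.
have [|l lS lmin] := @EVT_min_rV R n dist2 (@simplex n) _ (@compact_simplex n)
    (continuous_subspaceT cdist2).
  exists (delta_mx ord0 (Ordinal n0)); split=> [j|].
    by rewrite mxE ler0n.
  rewrite (bigD1 (Ordinal n0))//= mxE !eqxx big1 ?addr0// => j jn0.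
  by rewrite mxE (negbTE jn0) andbF.
rewrite inE in lS; set p := weighted_sum y l; exists (x - p) => j.
have up : 0 < dot (x - p) (x - p).
  apply: dotxx_gt0; rewrite subr_eq0; apply/eqP => xp; apply: xNhull => C [cC yC].
  by rewrite xp; apply: convex_set_weighted_sum => // i; apply: yC; exists i.
suff : dot (x - p) (y j - p) <= 0 by move: up; rewrite !dotBr; lra.
rewrite leNgt; apply/negP => pos.
have tmin (t : R) : 0 <= t <= 1 ->
    2 * t * dot (x - p) (y j - p) <= t ^+ 2 * dot (y j - p) (y j - p).
  move=> /andP[t0 t1].
  pose lt := (1 - t) *: l + t *: delta_mx ord0 j : 'rV[R]_n.
  have : simplex lt.
    split=> [k|].
      by rewrite !mxE addr_ge0// mulr_ge0 ?ler0n ?subr_ge0//; exact: lS.1.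
    rewrite (eq_bigr (fun k => (1 - t) * l ord0 k + t * (k == j)%:R)) => [|k _].
      rewrite big_split/= -!mulr_sumr lS.2 (bigD1 j)//= eqxx big1 ?addr0 ?mulr1.
        by rewrite subrK.
      by move=> k /negbTE ->.
    by rewrite !mxE eqxx.
  move=> /mem_set/lmin; rewrite /dist2 -/p.
  have -> : x - weighted_sum y lt = (x - p) - t *: (y j - p).
    have -> : weighted_sum y lt = (1 - t) *: p + t *: y j.
      rewrite /weighted_sum (eq_bigr
          (fun k => (1 - t) *: (l ord0 k *: y k) + t *: ((k == j)%:R *: y k))).
        rewrite big_split/= -!scaler_sumr -/(weighted_sum y l) -/p.
        rewrite (bigD1 j)//= eqxx scale1r big1 ?addr0//.
        by move=> k /negbTE ->; rewrite scale0r.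
      by move=> k _; rewrite !scalerA -scalerDl !mxE eqxx.
    by rewrite scalerBr scalerBl scale1r !opprD !opprK !addrA addrAC.
  move: (x - p) (y j - p) => w v.
  rewrite dotBl !dotBr dotZl !dotZr dotZl (dotC v w).
  by move=> h; nra.
set a := dot (x - p) (y j - p) in pos tmin.
(* If <x - p, y j - p> = a were positive, the parameter t = a / (a + b) would
   contradict the minimality of p. *)
set b := dot (y j - p) (y j - p) in tmin.
have b0 : 0 <= b by exact: dotxx_ge0.
have abP : 0 < a + b by lra.
have := tmin (a / (a + b)); rewrite divr_ge0 ?(ltW pos) ?(ltW abP)//=.
rewrite ler_pdivrMr// mul1r lerDl b0 => /(_ isT).
rewrite expr_div_n -[leRHS]mulrAC ler_pdivlMr ?exprn_gt0//.
have -> : 2 * (a / (a + b)) * a * (a + b) ^+ 2 = 2 * a ^+ 2 * (a + b).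
  by field; rewrite gt_eqF.
suff : 0 < a ^+ 2 * (2 * a + b) by lra.
by rewrite mulr_gt0 ?exprn_gt0//; lra.
Qed.

(** Finitely many strict inequalities survive a small change of direction. *)
Lemma exists_separating_rational_vector n (y : 'I_n -> 'rV[R]_d) x : (0 < n)%N ->
  ~ convex_hull (range y) x -> exists2 q : 'rV[rat]_d, q != 0 &
    forall j, 0 < dot (map_mx ratr q) (x - y j).
Proof.
move=> n0 /(exists_separating_vector n0)[u ux].
have : \forall v \near u, forall j, 0 < dot v (x - y j).
  apply: (@filter_forall _ _ (fun j v => 0 < dot v (x - y j)) (nbhs u)) => j.
  have cdot : (fun v => dot v (x - y j)) @ u --> dot u (x - y j).
    apply: (@continuous_dot _ id (fun=> x - y j)) => c; last exact: cst_continuous.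
    exact: coord_continuous.
  exact: (cvgr_gt _ cdot _ (ux j)).
move=> /nbhs_ballP[e /= e0 eu].
have /choice[q qP] : forall c, exists q : rat, `|u ord0 c - ratr q| < e.
  move=> c; have [|q] := @rat_in_itvoo R (u ord0 c) (u ord0 c + e).
    by rewrite ltrDl.
  rewrite in_itv/= => /andP[q1 q2]; exists q.
  by rewrite distrC gtr0_norm ?subr_gt0// ltrBlDl.
have qpos j : 0 < dot (map_mx ratr (\row_c q c)) (x - y j).
  apply: eu; split=> // i c; rewrite (ord1 i) /ball/= !mxE.
  exact: qP.
exists (\row_c q c) => //; apply/eqP => q0.
have := qpos (Ordinal n0); rewrite q0 map_mx0 /dot big1 ?ltxx// => c _.
by rewrite mxE mul0r.
Qed.

End separation.

(** * Boxes of tuples and translates of Lebesgue measure *)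

Section tuple_boxes.
Context (R : realType) (disp : measure_display) (V : measurableType disp).
Variable n : nat.

Definition box (A : 'I_n -> set V) : set (n.-tuple V) :=
  [set t | forall i, A i (tnth t i)].

(** The pi-system generating the sigma-algebra of tuples. *)
Definition measurable_boxes : set_system (n.-tuple V) :=
  [set box A | A in [set A | forall i, measurable (A i)]].

Lemma measurable_tuple_box A : (forall i, measurable (A i)) -> measurable (box A).
Proof.
move=> mA.
rewrite (_ : box A = \bigcap_(i in [set: 'I_n])
    ((fun t : n.-tuple V => tnth t i) @^-1` A i)); last first.
  by apply/seteqP; split=> t /= tA i; [move=> _|]; exact: tA.
apply: fin_bigcap_measurable => [|i _]; first exact: finite_finset.
rewrite -[X in measurable X]setTI.
by apply: measurable_tnth => //; exact: mA.
Qed.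

Lemma setI_closed_boxes : setI_closed measurable_boxes.
Proof.
move=> _ _ [A mA <-] [B mB <-]; exists (fun i => A i `&` B i) => [i|].
  exact: measurableI.
apply/seteqP; split=> [t tAB|t [tA tB] i]; last by split; [exact: tA|exact: tB].
by split=> i; have [] := tAB i.
Qed.

Lemma measurable_tupleE :
  (measurable : set_system (n.-tuple V)) = <<s measurable_boxes >>.
Proof.
apply/seteqP; split; last first.
  apply: smallest_sub; first exact: sigma_algebra_measurable.
  by move=> _ [A mA <-]; exact: measurable_tuple_box.
apply: smallest_sub; first exact: smallest_sigma_algebra.
rewrite -bigcup_seq => B [i _ [A mA <-]]; apply: sub_sigma_algebra.
exists (fun j => if j == i then A else setT) => [j|]; first by case: ifP.
apply/seteqP; split=> t /= tA; first by split=> //; have := tA i; rewrite eqxx.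
by move=> j; case: eqP => // ->; have [] := tA.
Qed.

Lemma tuple_measure_unique (m1 m2 : {measure set (n.-tuple V) -> \bar R})
    (F : nat -> 'I_n -> set V) :
  (forall k i, measurable (F k i)) -> \bigcup_k box (F k) = setT ->
  (forall k, (m1 (box (F k)) < +oo)%E) ->
  (forall A, (forall i, measurable (A i)) -> m1 (box A) = m2 (box A)) ->
  forall A, measurable A -> m1 A = m2 A.
Proof.
move=> mF covF Foo m12.
apply: (measure_unique measurable_boxes (fun k => box (F k))) => //.
- exact: measurable_tupleE.
- exact: setI_closed_boxes.
- by move=> k; exists (F k).
- by move=> _ [A mA <-]; exact: m12.
Qed.

End tuple_boxes.

Section translation.
Variable R : realType.

Lemma lebesgue_measure_translate (a : R) (A : set R) : measurable A ->
  lebesgue_measure [set x | A (x + a)] = lebesgue_measure A.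
Proof.
pose f : measurableTypeR R -> measurableTypeR R := fun x => x + a.
have mf : measurable_fun setT f by exact: measurable_funD.
pose pm := @measure_function_pushforward__canonical__measure_function_Measure
  _ _ _ _ R (@lebesgue_measure R) f mf.
move=> mA; apply/esym; apply: (@lebesgue_measure_unique R pm) => // _ [[b c]] _ <-.
rewrite /pm /= /pushforward (_ : f @^-1` _ = `]b - a, c - a]%classic).
  rewrite !lebesgue_measure_itv/= !lte_fin ltrD2r; case: ifPn => // _.
  by congr (_%:E); lra.
by apply/seteqP; split=> x; rewrite /f /= !in_itv/=; lra.
Qed.

(** The two measures agree on boxes, where the one-dimensional translation
    invariance applies to each side. *)
Lemma lebesgue_rV_translate d (v : 'rV[R]_d) (A : set 'rV[R]_d) : measurable A ->
  lebesgue_rV [set x | A (x + v)] = lebesgue_rV A.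
Proof.
pose f (t : d.-tuple (measurableTypeR R)) : d.-tuple (measurableTypeR R) :=
  [tuple tnth t i + v ord0 i | i < d].
have mf : measurable_fun setT f.
  apply/measurable_fun_tnthP => i.
  rewrite (_ : _ \o f = (fun t => tnth t i + v ord0 i)).
    apply: measurable_funD => //; exact: measurable_tnth.
  by apply/funext => t /=; rewrite tnth_mktuple.
pose pm := @measure_function_pushforward__canonical__measure_function_Measure
  _ _ _ _ R (lebesgue_tuple R d) f mf.
move=> mA; have mA' : measurable (@row_of_tuple R d @^-1` A).
  by rewrite -[X in measurable X]setTI; exact: measurable_row_of_tuple.
rewrite /lebesgue_rV /pushforward.
rewrite (_ : _ @^-1` _ = f @^-1` (@row_of_tuple R d @^-1` A)); last first.
  apply/funext => t /=; congr A; apply/rowP => i.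
  by rewrite !mxE tnth_mktuple.
have boxE (B : 'I_d -> set R) : (forall i, measurable (B i)) ->
    lebesgue_tuple R d (@box _ (measurableTypeR R) d B) =
    (\prod_(i < d) lebesgue_measure (B i))%E.
  exact: lebesgue_tuple_box.
apply/esym; apply: (@tuple_measure_unique R _ _ d (lebesgue_tuple R d) pm
  (fun k i => `[- k%:R, k%:R]%classic)) => //.
- apply/seteqP; split=> // t _.
  exists (Num.trunc (\sum_i `|tnth t i|)).+1 => // i; rewrite /= in_itv/= -ler_norml.
  have := @truncn_itv R (\sum_i `|tnth t i|); rewrite sumr_ge0// => /(_ isT).
  move=> /andP[_ /ltW]; apply: le_trans.
  by rewrite (bigD1 i)//= lerDl sumr_ge0.
- move=> k; pose F (i : 'I_d) : set R := `[- k%:R, k%:R]%classic.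
  suff : (\prod_(i < d) lebesgue_measure (F i) \is a fin_num)%E.
    by rewrite -(boxE F (fun=> measurable_itv _)) fin_numElt => /andP[].
  elim/big_ind: _ => // [x y|i _]; first exact: fin_numM.
  by rewrite lebesgue_measure_itv/=; case: ifP.
move=> B mB; transitivity (\prod_(i < d) lebesgue_measure (B i))%E.
  exact: boxE.
rewrite /pm /= /pushforward.
rewrite (_ : f @^-1` box B = box (fun i => [set x | B i (x + v ord0 i)])).
  rewrite boxE => [|i].
    by apply: eq_bigr => i _; apply/esym/lebesgue_measure_translate; exact: mB.
  rewrite -[X in measurable X]setTI.
  have mD : measurable_fun setT (fun x : R => x + v ord0 i).
    exact: measurable_funD.
  exact: (mD measurableT _ (mB i)).
by apply/seteqP; split=> t /= + i => /(_ i); rewrite /= tnth_mktuple.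
Qed.

End translation.

(** * Separated points and the volume of a shell *)

Section measurability.
Variables (R : realType) (d : nat).

Lemma measurable_open_rV (U : set 'rV[R]_d) : open U -> measurable U.
Proof. exact: sub_sigma_algebra. Qed.

Lemma measurable_coord (c : 'I_d) : measurable_fun setT (fun x : 'rV[R]_d => x ord0 c).
Proof.
apply: (measurability _ (RGenOpens.measurableE R)) => _ [_ [a [b ->] <-]].
rewrite setTI; apply: measurable_open_rV; apply: open_comp; last exact: interval_open.
by move=> x _; exact: coord_continuous.
Qed.

Lemma measurable_dot (u : 'rV[R]_d) : measurable_fun setT (dot u).
Proof.
apply: measurable_sum => c; apply: measurable_funM; first exact: measurable_cst.
exact: measurable_coord.
Qed.

Lemma measurable_translate (v : 'rV[R]_d) :
  measurable_fun setT (fun x : 'rV[R]_d => x + v).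
Proof.
apply: (@measurability _ _ _ _ _ _ (@open 'rV[R]_d)) => // _ [U oU <-].
rewrite setTI; apply: measurable_open_rV; apply: open_comp => // x _.
by apply: continuousD; [exact: cvg_id|exact: cst_continuous].
Qed.

End measurability.

Section beyond.
Variables (R : realType) (d n : nat).
Local Notation V := 'rV[R]_d.

(** The norm of q makes e a Euclidean distance, although rational directions
    cannot be normalized. Keeping x and y together in a product space is what
    Fubini needs. *)
Definition cap (e : R) (J : {set 'I_n}) (q : 'rV[rat]_d) : set (V * n.-tuple V) :=
  [set p | forall j, j \in J ->
    e * euclidean_norm (map_mx ratr q) < dot (map_mx ratr q) (p.1 - tnth p.2 j)].

(** Rational directions make this a countable union of measurable sets. For
    e = 0 and nonempty J, its section at y is the complement of the hull of the
    y j; for e > 0 it is the set of points at distance more than e from it. *)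
Definition beyond e J : set (V * n.-tuple V) :=
  \bigcup_(q in [set q | q != 0]) cap e J q.

Lemma measurable_cap e J q : measurable (cap e J q).
Proof.
pose r := map_mx ratr q : V.
rewrite (_ : cap e J q = \bigcap_(j in [set` J])
    [set p | e * euclidean_norm r < dot r p.1 - dot r (tnth p.2 j)]); last first.
  by apply/seteqP; split=> p /= pJ j jJ; have /= := pJ j jJ; rewrite dotBr.
apply: fin_bigcap_measurable => [|j _]; first exact: finite_finset.
rewrite -[X in measurable X]setTI.
have mf : measurable_fun setT
    (fun p : V * n.-tuple V => dot r p.1 - dot r (tnth p.2 j)).
  apply: measurable_funB; first exact: (measurableT_comp (measurable_dot r)).
  apply: (measurableT_comp (measurable_dot r)).
  by apply: (measurableT_comp (measurable_tnth j)).
have := mf measurableT _ (measurable_itv `]e * euclidean_norm r, +oo[).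
congr measurable; congr (_ `&` _).
by apply/seteqP; split=> p; rewrite /= in_itv/= andbT.
Qed.

Lemma measurable_bigcup_cap e J (D : set 'rV[rat]_d) :
  measurable (\bigcup_(q in D) cap e J q).
Proof.
rewrite bigcup_mkcond; apply: countable_bigcupT_measurable => [|q].
  exact: countableP.
by case: ifP => _ //; exact: measurable_cap.
Qed.

Lemma measurable_beyond e J : measurable (beyond e J).
Proof. exact: measurable_bigcup_cap. Qed.

Lemma subset_beyond e (J J' : {set 'I_n}) :
  J \subset J' -> beyond e J' `<=` beyond e J.
Proof.
by move=> /fintype.subsetP JJ' p [q q0 pq]; exists q => // j /JJ'; exact: pq.
Qed.

End beyond.

Section shell.
Variables (R : realType) (d n : nat).
Local Notation V := 'rV[R]_d.

Definition cube (r : R) : set V := [set x | forall c, `|x ord0 c| <= r].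

Lemma measurable_cube r : measurable (cube r).
Proof.
rewrite (_ : cube r = \bigcap_(c in [set: 'I_d])
    ((fun x : V => x ord0 c) @^-1` `[- r, r])).
  apply: fin_bigcap_measurable => [|c _]; first exact: finite_finset.
  by rewrite -[X in measurable X]setTI; exact: measurable_coord.
by apply/seteqP; split=> x /= xr c; [move=> _|]; have := xr c;
  rewrite /= in_itv/= -ler_norml //; exact.
Qed.

Lemma lebesgue_rV_cube r : 0 <= r -> lebesgue_rV (cube r) = ((2 * r) ^+ d)%:E.
Proof.
move=> r0; rewrite (_ : cube r =
    [set x | forall c, `[- r, r]%classic (x ord0 c)]).
  rewrite (lebesgue_rV_box (A := fun=> `[- r, r]%classic))//.
  rewrite (eq_bigr (fun=> (2 * r)%:E)) => [|i _].
    by rewrite big_const_ord iter_mule mule1 -EFin_expe.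
  rewrite lebesgue_measure_itv/= lte_fin; case: ltP => [_|rr].
    by rewrite -EFinD; congr _%:E; lra.
  by congr _%:E; lra.
by apply/seteqP; split=> x /= xr c; have := xr c; rewrite /= in_itv/= -ler_norml.
Qed.

Lemma le_measure_bigsetU (disp : measure_display) (T : measurableType disp)
    (mu : {measure set T -> \bar R}) (I : finType) (F : I -> set T) :
  (forall i, measurable (F i)) ->
  (mu (\big[setU/set0]_i F i) <= \sum_i mu (F i))%E.
Proof.
move=> mF; suff [] : (mu (\big[setU/set0]_i F i) <= \sum_i mu (F i))%E /\
    measurable (\big[setU/set0]_i F i) by [].
elim/big_rec2: _ => [|i x A _ [le mA]]; first by rewrite measure0.
split; last exact: measurableU.
by apply: (le_trans (measureU2 _ _ _)) => //; rewrite leeD2l.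
Qed.

(** The L disjoint copies of A obtained from multiples of v all fit in the cube
    of side 4. *)
Lemma lebesgue_rV_disjoint_translates (A : set V) (v : V) (L : nat) :
  measurable A -> A `<=` cube 1 -> (0 < L)%N ->
  (forall c, L.-1%:R * `|v ord0 c| <= 1) ->
  (forall x k, (0 < k)%N -> A x -> ~ A (x + k%:R *: v)) ->
  (L%:R%:E * lebesgue_rV A <= (4 ^+ d)%:E)%E.
Proof.
move=> mA A1 L0 vL disj.
pose F k := [set x | A (x + (- (k%:R *: v)))].
have mF k : measurable (F k).
  rewrite -[F k]setTI.
  exact: (measurable_translate (- (k%:R *: v))) measurableT _ mA.
have tF : trivIset setT F.
  apply: ltn_trivIset => i j ji; rewrite -subset0 => x [Fix Fjx].
  apply: (disj (x - i%:R *: v) (i - j)%N) => //; first by rewrite subn_gt0.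
  by rewrite natrB 1?ltnW// scalerBl -addrA addKr.
have mU : measurable (\big[setU/set0]_(k < L) F k).
  by apply: bigsetU_measurable => k _; exact: mF.
rewrite (_ : _ * _ = lebesgue_rV (\big[setU/set0]_(k < L) F k))%E; last first.
  rewrite measure_bigsetU// (eq_bigr (fun=> lebesgue_rV A)) => [|k _].
    by rewrite sumr_const card_ord mule_natl.
  exact: lebesgue_rV_translate.
rewrite (_ : 4 ^+ d = (2 * 2) ^+ d); last by congr (_ ^+ _); lra.
rewrite -lebesgue_rV_cube//; apply: le_measure; rewrite ?inE//.
  exact: measurable_cube.
rewrite -bigcup_mkord => x [k /= kL] /A1 xk c.
have := xk c; rewrite !mxE => xkc; rewrite -[x _ _](subrK (k%:R * v ord0 c)).
rewrite (le_trans (ler_normD _ _))// -[leRHS]/(1 + 1) lerD//.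
rewrite normrM ger0_norm// (le_trans _ (vL c))// ler_wpM2r// ler_nat.
by rewrite -ltnS prednK.
Qed.

Definition shell (e : R) (J : {set 'I_n}) : set (V * n.-tuple V) :=
  (fst @^-1` cube 1 `&` beyond 0 J) `\` beyond e J.

(** The axis c and the sign (-1)^s tell along which coordinate vector the points
    of this part of the shell are to be moved. *)
Definition directed_shell (e : R) (J : {set 'I_n}) (c : 'I_d) (s : bool) :
    set (V * n.-tuple V) :=
  (fst @^-1` cube 1 `&` \bigcup_(q in [set q : 'rV[rat]_d | q != 0 /\
    forall k, `|q ord0 k| <= (-1) ^+ s * q ord0 c]) cap 0 J q) `\` beyond e J.

Lemma measurable_fst_cube r : measurable (fst @^-1` cube r : set (V * n.-tuple V)).
Proof.
rewrite -[X in measurable X]setTI; apply: measurable_fst => //.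
exact: measurable_cube.
Qed.

Lemma measurable_shell e J : measurable (shell e J).
Proof.
apply: measurableD; last exact: measurable_beyond.
by apply: measurableI; [exact: measurable_fst_cube|exact: measurable_beyond].
Qed.

Lemma measurable_directed_shell e J c s : measurable (directed_shell e J c s).
Proof.
apply: measurableD; last exact: measurable_beyond.
by apply: measurableI; [exact: measurable_fst_cube|exact: measurable_bigcup_cap].
Qed.

Lemma shellE e J : (0 < d)%N ->
  shell e J = \big[setU/set0]_(cs : 'I_d * bool) directed_shell e J cs.1 cs.2.
Proof.
move=> d0; rewrite -bigcup_seq; apply/seteqP; split=> p.
  move=> [[p1 [q q0 pq]] pNe].
  pose c := [arg max_(c > Ordinal d0) `|q ord0 c|]%O.
  have qc k : `|q ord0 k| <= `|q ord0 c|.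
    by rewrite /c; case: arg_maxP => // i _; exact.
  exists (c, q ord0 c < 0) => /=; first by rewrite mem_index_enum.
  split=> //; split=> //; exists q => //; split=> // k.
  by rewrite -normrEsign.
move=> [[c s] _] [[p1 [q [q0 _] pq]] pNe]; split=> //; split=> //.
by exists q.
Qed.

(** A step of length d e along the axis c, in the direction of the sign,
    increases <q, .> by d e |q_c| >= e |q|. It therefore leads from this set
    to points separated with margin e, which are outside of it. *)
Lemma lebesgue_directed_shell e J c s (y : n.-tuple V) : 0 < e ->
  (lebesgue_rV (ysection (directed_shell e J c s) y) <=
    (4 ^+ d * (d%:R * e))%:E)%E.
Proof.
move=> e0; have d0 : (0 < d)%N by exact: leq_ltn_trans (ltn_ord c).
have t0 : 0 < d%:R * e by rewrite mulr_gt0// ltr0n.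
have [t tE] : exists t, t = d%:R * e by exists (d%:R * e).
rewrite -tE in t0 *; set A := ysection _ _.
pose v : V := ((-1) ^+ s * t) *: delta_mx ord0 c.
have ti0 : 0 <= t^-1 by rewrite invr_ge0 ltW.
have /andP[L1 L2] := truncn_itv ti0; set L := (Num.trunc t^-1).+1 in L1 L2.
have mA : measurable A.
  by apply: measurable_ysection; exact: measurable_directed_shell.
have AE x : A x <-> directed_shell e J c s (x, y).
  by rewrite /A /ysection /= inE.
have : (L%:R%:E * lebesgue_rV A <= (4 ^+ d)%:E)%E.
  apply: (@lebesgue_rV_disjoint_translates _ v) => //.
  - by move=> x /AE[[]].
  - move=> k; rewrite !mxE eqxx /= !normrM normrX normrN1 expr1n mul1r.
    rewrite (gtr0_norm t0); case: (k == c); last by rewrite normr0 !mulr0.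
    by rewrite normr1 mulr1 -ler_pdivlMr// mul1r.
  - move=> x k k0 /AE[[_ [q [q0 qc] xq]] _] /AE[_]; apply.
    exists q => // j jJ; have /= := xq j jJ; rewrite mul0r; set r := map_mx _ _ => rx.
    rewrite addrAC dotDr -[ltLHS]add0r ltr_leD//.
    have normqc : `|q ord0 c| = (-1) ^+ s * q ord0 c.
      apply/eqP; rewrite eq_le qc /= (le_trans (ler_norm _))//.
      by rewrite normrM normrX normrN1 expr1n mul1r.
    have rE : (-1) ^+ s * r ord0 c = `|r ord0 c|.
      by rewrite mxE -ratr_norm normqc rmorphM rmorph_sign.
    have -> : dot r (k%:R *: v) = k%:R * (t * `|r ord0 c|).
      rewrite !dotZr -rE /dot (bigD1 c)//= big1 => [|i ic].
        by rewrite [delta_mx _ _ _ _]mxE !eqxx mulr1 addr0; ring.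
      by rewrite [delta_mx _ _ _ _]mxE (negbTE ic) andbF mulr0.
    apply: (@le_trans _ _ (t * `|r ord0 c|)).
      rewrite tE -mulrA mulrCA ler_wpM2l ?(ltW e0)//.
      apply: euclidean_norm_le_max_coord => i.
      by rewrite !mxE -!ratr_norm ler_rat normqc.
    by rewrite ler_peMl ?mulr_ge0 ?(ltW t0)// ler1n.
rewrite mulrC EFinM -lee_pdivrMl// => LA; apply: le_trans LA.
by rewrite lee_wpmul2r// lee_fin ltW.
Qed.

Lemma lebesgue_shell e J (y : n.-tuple V) : (0 < d)%N -> 0 < e ->
  (lebesgue_rV (ysection (shell e J) y) <=
    ((2 * d ^ 2 * 4 ^ d)%:R * e)%:E)%E.
Proof.
move=> d0 e0; rewrite shellE//.
rewrite (big_morph (fun A => ysection A y) (id1 := set0) (op1 := setU)); first last.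
- exact: ysection0.
- move=> A B; apply/seteqP; split=> x; rewrite /ysection /= in_setU.
    by move=> /orP[]; [left|right].
  by move=> [] ->; rewrite ?orbT.
apply: le_trans; first apply: le_measure_bigsetU => cs.
  by apply: measurable_ysection; exact: measurable_directed_shell.
apply: (@le_trans _ _ (\sum_(cs : 'I_d * bool) (4 ^+ d * (d%:R * e))%:E)%E).
  by apply: lee_sum => cs _; exact: lebesgue_directed_shell.
rewrite sumEFin lee_fin sumr_const card_prod card_ord card_bool.
rewrite -[leLHS]mulr_natl !natrM !natrX.
by rewrite le_eqVlt; apply/orP; left; apply/eqP; ring.
Qed.

End shell.

(** * Independence of blocks of random variables *)

Section masked.
Context (R : realType) (disp disp' : measure_display) (T : measurableType disp)
  (V : measurableType disp') (P : probability T R) (n : nat)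
  (X : 'I_n -> {RV P >-> V}) (v0 : V).
Implicit Types J : {set 'I_n}.

(** The block of the X i with i in J, embedded in the space of n-tuples so that
    all blocks take values in the same measurable space. *)
Definition masked J (w : T) : n.-tuple V :=
  [tuple if i \in J then X i w else v0 | i < n].

Lemma tnth_masked J w i : i \in J -> tnth (masked J w) i = X i w.
Proof. by move=> iJ; rewrite tnth_mktuple iJ. Qed.

Lemma measurable_masked J : measurable_fun setT (masked J).
Proof.
apply/measurable_fun_tnthP => i.
have [iJ|iJ] := boolP (i \in J).
  rewrite (_ : _ \o _ = X i) //.
  by apply/funext => w /=; rewrite tnth_masked.
rewrite (_ : _ \o _ = cst v0) //.
by apply/funext => w /=; rewrite tnth_mktuple (negbTE iJ).
Qed.

HB.instance Definition _ J :=
  isMeasurableFun.Build _ _ _ _ (masked J) (measurable_masked J).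

Definition masked_RV J : {RV P >-> n.-tuple V} := masked J.

Lemma preimage_masked_box J (A : 'I_n -> set V) :
  masked J @^-1` box A = if `[< forall i, i \notin J -> A i v0 >]
    then \bigcap_(i in [set` J]) X i @^-1` A i else set0.
Proof.
case: asboolP => [A0|nA0]; apply/seteqP; split=> // w /=.
- by move=> wA i iJ; have := wA i; rewrite tnth_masked.
- move=> wA i; have [iJ|iJ] := boolP (i \in J).
    by rewrite tnth_masked//; exact: wA.
  by rewrite tnth_mktuple (negbTE iJ); exact: A0.
by move=> wA; apply: nA0 => i iJ; have := wA i; rewrite tnth_mktuple (negbTE iJ).
Qed.

(** Both sides are finite measures of A, and boxes form a generating
    pi-system. *)
Lemma independent_boxes_event (Y : {RV P >-> n.-tuple V}) (E : set T) :
  measurable E ->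
  (forall A, (forall i, measurable (A i)) ->
    P (Y @^-1` box A `&` E) = (P (Y @^-1` box A) * P E)%E) ->
  forall A, measurable A -> P (Y @^-1` A `&` E) = (P (Y @^-1` A) * P E)%E.
Proof.
move=> mE boxE A mA.
pose m1 := distribution P Y.
have mY : measurable_fun setT Y by [].
pose m2 := @measure_function_pushforward__canonical__measure_function_Measure
  _ _ _ _ R (mrestr P mE) Y mY.
have PE0 : 0 <= fine (P E) by rewrite fine_ge0.
pose m3 := mscale (NngNum PE0) m1.
have m3E B : m3 B = (P (Y @^-1` B) * P E)%E.
  by rewrite /m3 /mscale /= fineK ?fin_num_measure// muleC.
have := @tuple_measure_unique R _ V n m2 m3 (fun _ _ => setT).
move=> /(_ (fun _ _ => measurableT)) m23.
transitivity (m2 A) => //; rewrite m23 ?[LHS]m3E//.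
- by apply/seteqP; split=> // t _; exists 0%N.
- move=> k; apply: (@le_lt_trans _ _ 1%E); last by rewrite ltry.
  apply: probability_le1.
  apply: measurableI => //; rewrite -[X in measurable X]setTI.
  exact: (mY measurableT _ (measurable_tuple_box (fun=> measurableT))).
- by move=> B mB; rewrite [RHS]m3E; exact: boxE.
Qed.

Hypothesis indepX : independent_RVs X.

(** Extends the product rule from boxes in two steps, one block at a time. *)
Lemma masked_independent J1 J2 : (forall i, i \in J1 -> i \notin J2) ->
  forall A B, measurable A -> measurable B ->
    P (masked J1 @^-1` A `&` masked J2 @^-1` B) =
    (P (masked J1 @^-1` A) * P (masked J2 @^-1` B))%E.
Proof.
move=> J12 A B mA mB.
have mpre J C : measurable C -> measurable (masked J @^-1` C).
  by move=> mC; rewrite -[X in measurable X]setTI; exact: measurable_masked.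
apply: (independent_boxes_event (Y := masked_RV J1)) => // [|{mA}{}A mA].
  exact: mpre.
rewrite setIC muleC; apply: (independent_boxes_event (Y := masked_RV J2)) => //.
  by apply: mpre; exact: measurable_tuple_box.
move=> {mB}{}B mB; rewrite /masked_RV /= !preimage_masked_box.
case: ifPn => _; last by rewrite set0I measure0 mul0e.
case: ifPn => _; last by rewrite setI0 measure0 mule0.
pose C i := if i \in J2 then B i else A i.
rewrite (_ : _ `&` _ = \bigcap_(i in [set` J2 :|: J1]) X i @^-1` C i).
  rewrite !indepX// => [|i]; last by rewrite /C; case: ifP.
  rewrite (bigID (fun i => i \in J2)) /=; congr (_ * _)%E.
    apply: eq_big => [i|i /andP[_ iJ]]; last by rewrite /C iJ.
    by rewrite inE andb_idl// => ->.
  apply: eq_big => [i|i /andP[_ /negbTE iJ]]; last by rewrite /C iJ.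
  by rewrite inE; have := J12 i; do 2!case: (i \in _) => //; move=> /(_ isT).
apply/seteqP; split=> w /=.
  move=> [wB wA] i /=; rewrite inE /C; case: ifPn => [iJ _|_ /= iJ].
    exact: wB.
  exact: wA.
move=> wC; split=> i /= iJ; have := wC i; rewrite /= inE iJ ?orbT /C ?iJ; first exact.
by rewrite (negbTE (J12 _ iJ)); exact.
Qed.

End masked.

Section independent_pair.
Context (R : realType) (disp disp1 disp2 : measure_display)
  (T : measurableType disp) (W1 : measurableType disp1)
  (W2 : measurableType disp2) (P : probability T R)
  (Y1 : {RV P >-> W1}) (Y2 : {RV P >-> W2}).
Hypothesis indepY : forall A B, measurable A -> measurable B ->
  P (Y1 @^-1` A `&` Y2 @^-1` B) = (P (Y1 @^-1` A) * P (Y2 @^-1` B))%E.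

Local Notation pairY := (fun w => (Y1 w, Y2 w)).

Let measurable_pairY : measurable_fun setT pairY.
Proof. exact: measurable_fun_pair. Qed.

Let law := @measure_function_pushforward__canonical__measure_function_Measure
  _ _ _ _ R P _ measurable_pairY.

Lemma pair_law S : measurable S ->
  (distribution P Y1 \x distribution P Y2)%E S = P (pairY @^-1` S).
Proof.
by move=> mS; rewrite (@product_measure_unique _ _ _ _ _ _ _ law).
Qed.

Lemma probability_pair S : measurable S ->
  P (pairY @^-1` S) = (\int[P]_w distribution P Y1 (ysection S (Y2 w)))%E.
Proof.
move=> mS; rewrite -pair_law//.
rewrite (@product_measure_unique _ _ _ _ _ _ _
  (distribution P Y1 \x^ distribution P Y2)%E)//; last first.
  by move=> A B mA mB; exact: product_measure2E.
apply: (@ge0_integral_distribution _ _ _ _ _ P Y2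
  (distribution P Y1 \o ysection S)) => //.
exact: measurable_fun_ysection.
Qed.

Lemma integral_mul_independent (f : W1 -> \bar R) (g : W2 -> \bar R) :
  measurable_fun setT f -> measurable_fun setT g ->
  (forall x, 0 <= f x)%E -> (forall y, 0 <= g y)%E ->
  (\int[P]_w (f (Y1 w) * g (Y2 w)) =
   \int[P]_w f (Y1 w) * \int[P]_w g (Y2 w))%E.
Proof.
move=> mf mg f0 g0.
pose h p := (f p.1 * g p.2)%E.
have mh : measurable_fun setT h.
  by apply: emeasurable_funM; exact: measurableT_comp.
have h0 p : (0 <= h p)%E by exact: mule_ge0.
transitivity (\int[law]_p h p)%E; first by rewrite ge0_integral_pushforward.
transitivity (\int[distribution P Y1 \x distribution P Y2]_p h p)%E.
  by apply: eq_measure_integral => S mS _; apply/esym; exact: pair_law.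
rewrite fubini_tonelli1// /fubini_F /h /=.
under eq_integral do rewrite ge0_integralZl//.
rewrite ge0_integralZr//; last exact: integral_ge0.
by rewrite !ge0_integral_distribution.
Qed.

End independent_pair.

(** * The expected missing mass *)

Section extremal_points.
Variables (R : realType) (d n : nat).
Local Notation V := 'rV[R]_d.
Implicit Types (J : {set 'I_n}) (y : n.-tuple V).

Definition extremal e J y : {set 'I_n} :=
  [set i in J | `[< (fst @^-1` cube 1 `&` beyond e (J :\ i)) (tnth y i, y) >]].

Lemma card_extremal J y (r : R) : (0 < d)%N -> 0 < r <= 1 ->
  #|extremal (r ^+ 2) J y|%:R * r ^+ d.-1 <= (7 * d)%:R ^+ d.
Proof.
move=> d0 r01; set E := extremal _ _ _.
have /choice[q qP] : forall i, exists q : 'rV[rat]_d, i \in E -> q != 0 /\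
    forall j, j \in J :\ i -> r ^+ 2 * euclidean_norm (map_mx ratr q) <
      dot (map_mx ratr q) (tnth y i - tnth y j).
  move=> i; have [|_] := boolP (i \in E); last by exists 0.
  by rewrite inE => /andP[_ /asboolP[_ [q q0 yq]]]; exists q.
pose v i : V := map_mx ratr (q i).
have v0 i : i \in E -> 0 < euclidean_norm (v i).
  move=> /qP[q0 _]; rewrite euclidean_normE sqrtr_gt0 dotxx_gt0//.
  by rewrite map_mx_eq0.
apply: (@separated_vertices_card R d _ E (fun i => tnth y i)
  (fun i => (euclidean_norm (v i))^-1 *: v i)) => // [i c|i iE|i j iE jE ji].
- by rewrite inE => /andP[_ /asboolP[+ _]]; exact.
- rewrite euclidean_normE dotZl dotZr mulrA -invfM -expr2 sqr_sqrtr ?dotxx_ge0//.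
  by rewrite mulVf// gt_eqF// -sqrtr_gt0 -euclidean_normE; exact: v0.
- rewrite dotZl ler_pdivlMl ?v0// mulrC ltW//.
  by apply: (qP i iE).2; rewrite 2!inE ji; move: jE; rewrite inE => /andP[].
Qed.

End extremal_points.

Section first_moment.
Context (R : realType) (d n : nat) (disp : measure_display)
  (T : measurableType disp) (P : probability T R).
Local Notation V := 'rV[R]_d.
Variables (X : 'I_n -> {RV P >-> V}) (nu : probability V R) (M : R).
Hypothesis indepX : independent_RVs X.
Hypothesis lawX : forall i A, measurable A -> P (X i @^-1` A) = nu A.
Hypothesis nu_le : forall A, measurable A -> (nu A <= M%:E * lebesgue_rV A)%E.
Implicit Types (J : {set 'I_n}) (S : set (V * n.-tuple V)).

Local Notation Y := (masked_RV X 0).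

(** S only looks at the coordinates of the tuple indexed by J; this is how an
    event about the whole sample is recognized as an event about a block. *)
Definition depends_on J S := forall x y y',
  (forall j, j \in J -> tnth y j = tnth y' j) -> S (x, y) -> S (x, y').

Lemma depends_on_cap e J q : depends_on J (cap (R := R) (d := d) e J q).
Proof. by move=> x y y' yy' xy j jJ; rewrite /= -yy'//; exact: xy. Qed.

Lemma depends_on_beyond e J : depends_on J (beyond (R := R) (d := d) e J).
Proof.
by move=> x y y' yy' [q q0 xy]; exists q => //; exact: depends_on_cap xy.
Qed.

Lemma depends_on_shell e J : depends_on J (shell (R := R) (d := d) e J).
Proof.
move=> x y y' yy' [[xc b0] be]; split; first by split=> //; exact: depends_on_beyond b0.
by apply: contra_not be; apply: depends_on_beyond => j jJ; rewrite yy'.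
Qed.

Lemma ysection_masked J J' S w : depends_on J S -> J \subset J' ->
  ysection S (Y J' w) = ysection S (Y [set: 'I_n]%SET w).
Proof.
move=> dS /fintype.subsetP JJ'; apply/seteqP; split=> x; rewrite /ysection /= !inE.
  by apply: dS => j /JJ' jJ'; rewrite !tnth_masked.
by apply: dS => j /JJ' jJ'; rewrite !tnth_masked.
Qed.

(** Fubini for X i and the independent block J. *)
Lemma probability_fresh_point J i S :
  i \notin J -> depends_on J S -> measurable S ->
  P [set w | S (X i w, Y [set: 'I_n]%SET w)] =
  (\int[P]_w nu (ysection S (Y [set: 'I_n]%SET w)))%E.
Proof.
move=> iJ dS mS.
have indep A B : measurable A -> measurable B ->
    P (X i @^-1` A `&` Y J @^-1` B) = (P (X i @^-1` A) * P (Y J @^-1` B))%E.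
  move=> mA mB.
  have E : X i = (fun t => tnth t i) \o masked X 0 [set i]%SET :> (T -> V).
    by apply/funext => w /=; rewrite tnth_masked// set11.
  have J1J : forall j, j \in [set i]%SET -> j \notin J by move=> j /set1P ->.
  rewrite E; apply: (@masked_independent _ _ _ _ _ _ _ X 0 indepX _ _ J1J
    ((fun t => tnth t i) @^-1` A) B) => //.
  by rewrite -[X in measurable X]setTI; exact: measurable_tnth.
transitivity (P ((fun w => (X i w, Y J w)) @^-1` S)).
  congr (P _); apply/seteqP; split=> w /=; apply: dS => j jJ.
    by rewrite !tnth_masked.
  by rewrite !tnth_masked.
rewrite (probability_pair indep mS); apply: eq_integral => w _.
rewrite (ysection_masked w dS (subxx J)).
by apply: lawX; apply: measurable_ysection.
Qed.

(** The nu-mass of the part of the cube outside the hull of the y j, j in J. *)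
Definition missing_mass J (y : n.-tuple V) : \bar R :=
  nu (ysection (fst @^-1` cube 1 `&` beyond 0 J) y).

Lemma measurable_cube_beyond e J :
  measurable (fst @^-1` cube 1 `&` beyond e J : set (V * n.-tuple V)).
Proof.
by apply: measurableI; [exact: measurable_fst_cube|exact: measurable_beyond].
Qed.

Lemma measurable_missing_mass J : measurable_fun setT (missing_mass J).
Proof. by apply: measurable_fun_ysection; exact: measurable_cube_beyond. Qed.

Lemma depends_on_cube_beyond e J :
  depends_on J (fst @^-1` cube 1 `&` beyond (R := R) (d := d) e J).
Proof.
by move=> x y y' yy' [xc xe]; split=> //; exact: depends_on_beyond xe.
Qed.

Lemma missing_mass_subset J J' y :
  J \subset J' -> (missing_mass J' y <= missing_mass J y)%E.
Proof.
move=> JJ'; apply: le_measure; rewrite ?inE.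
- by apply: measurable_ysection; exact: measurable_cube_beyond.
- by apply: measurable_ysection; exact: measurable_cube_beyond.
by apply/le_ysection => p [pc pb]; split=> //; exact: subset_beyond pb.
Qed.

Lemma measurable_pair_event i S : measurable S ->
  measurable [set w | S (X i w, Y [set: 'I_n]%SET w)].
Proof.
move=> mS; rewrite -[X in measurable X]setTI.
have mp : measurable_fun setT (fun w => (X i w, Y [set: 'I_n]%SET w)).
  exact: measurable_fun_pair.
exact: mp.
Qed.

(** Removing i from J can only increase the missing mass, and the mean of the
    missing mass of J minus i is the probability that X i is separated from the
    other points of J. Either this happens with margin r^2, and [card_extremal]
    bounds the number of such i, or X i falls in the shell of the others, whose
    mass is small. *)
Lemma integral_missing_mass_le J (r : R) : (0 < d)%N -> 0 < r <= 1 -> 0 <= M ->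
  (#|J|%:R%:E * \int[P]_w missing_mass J (Y [set: 'I_n]%SET w) <=
    ((7 * d)%:R ^+ d / r ^+ d.-1 +
     #|J|%:R * (M * ((2 * d ^ 2 * 4 ^ d)%:R * r ^+ 2)))%:E)%E.
Proof.
move=> d0 r01 M0; have /andP[r0 r1] := r01; set I := (\int[P]_w _)%E.
set C := (2 * d ^ 2 * 4 ^ d)%:R * r ^+ 2.
pose Z := Y [set: 'I_n]%SET.
pose N i := [set w | (fst @^-1` cube 1 `&` beyond (r ^+ 2) (J :\ i)) (X i w, Z w)].
have mN i : measurable (N i).
  by apply: measurable_pair_event; exact: measurable_cube_beyond.
have sumN : (\sum_(i in J) P (N i) <= ((7 * d)%:R ^+ d / r ^+ d.-1)%:E)%E.
  pose f i w : R := if i \in J then \1_(N i) w else 0.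
  have f0 i w : 0 <= f i w by rewrite /f; case: ifP.
  have mf i : measurable_fun setT (EFin \o f i).
    apply/measurable_EFinP; rewrite /f; case: (i \in J); last exact: measurable_cst.
    exact: measurable_indic.
  rewrite big_mkcond (eq_bigr (fun i => \int[P]_w (f i w)%:E)%E) => [|i _]; last first.
    rewrite /f; case: (i \in J) => /=; last by rewrite integral0.
    by rewrite integral_indic ?setIT.
  rewrite -ge0_integral_sum//; last by move=> *; rewrite lee_fin.
  rewrite -[leRHS]mule1 -(probability_setT P) -integral_cst//.
  apply: ge0_le_integral => //.
  - by move=> w _; apply: sume_ge0 => i _; rewrite lee_fin.
  - exact: emeasurable_sum.
  move=> w _; rewrite sumEFin lee_fin ler_pdivlMr ?exprn_gt0//.
  apply: le_trans (card_extremal J (Z w) d0 r01).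
  rewrite ler_wpM2r ?exprn_ge0 ?(ltW r0)//.
  rewrite -sum1_card natr_sum [leRHS]big_mkcond; apply: ler_sum => i _ /=.
  rewrite /f inE; case: ifPn => //= iJ; rewrite indicE; case: asboolP => [Ni|nNi].
    by rewrite lern1 leq_b1.
  rewrite (_ : _ \in _ = false) //; apply/negbTE; rewrite notin_setE => Nw.
  by apply: nNi; rewrite tnth_masked ?inE.
have one i : i \in J -> (I <= P (N i) + (M * C)%:E)%E.
  move=> iJ; have iJi : i \notin J :\ i by rewrite setD11.
  apply: (@le_trans _ _ (\int[P]_w missing_mass (J :\ i) (Z w)))%E.
    apply: ge0_le_integral => //.
    - exact: (measurableT_comp (measurable_missing_mass J)).
    - exact: (measurableT_comp (measurable_missing_mass (J :\ i))).
    by move=> w _; apply: missing_mass_subset; exact: subD1set.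
  rewrite /missing_mass -(probability_fresh_point iJi); last 2 first.
  - exact: depends_on_cube_beyond.
  - exact: measurable_cube_beyond.
  pose Sh := [set w | shell (r ^+ 2) (J :\ i) (X i w, Z w)].
  have mSh : measurable Sh by apply: measurable_pair_event; exact: measurable_shell.
  have shP : (P Sh <= (M * C)%:E)%E.
    rewrite (probability_fresh_point iJi); last 2 first.
    - exact: depends_on_shell.
    - exact: measurable_shell.
    rewrite -[leRHS]mule1 -(probability_setT P) -integral_cst//.
    apply: ge0_le_integral => //.
    - apply: (measurableT_comp 
        (f := fun y => nu (ysection (shell (r ^+ 2) (J :\ i)) y))) => //.
      by apply: measurable_fun_ysection; exact: measurable_shell.
    move=> w _; apply: (le_trans (nu_le _)).
      by apply: measurable_ysection; exact: measurable_shell.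
    rewrite EFinM lee_wpmul2l ?lee_fin//; apply: lebesgue_shell => //.
    by rewrite exprn_gt0.
  apply: le_trans (leeD2l _ shP).
  apply: (le_trans _ (measureU2 P (mN i) mSh)).
  apply: le_measure; rewrite ?inE.
  - by apply: measurable_pair_event; exact: measurable_cube_beyond.
  - exact: measurableU.
  move=> w [wc wb].
  have [wb'|wb'] := pselect (beyond (r ^+ 2) (J :\ i) (X i w, Z w)).
    by left; split.
  by right; split.
have -> : (#|J|%:R%:E * I = \sum_(i in J) I)%E.
  by rewrite sumr_const mule_natl.
apply: (@le_trans _ _ (\sum_(i in J) (P (N i) + (M * C)%:E)))%E.
  by apply: lee_sum => i iJ; exact: one.
rewrite big_split /= EFinD leeD//.
by rewrite [in leRHS]EFinM mule_natl sumr_const.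
Qed.

End first_moment.

(** * Moments of the missing mass *)

Section moments.
Context (R : realType) (d n : nat) (disp : measure_display)
  (T : measurableType disp) (P : probability T R).
Local Notation V := 'rV[R]_d.
Variables (X : 'I_n -> {RV P >-> V}) (nu : probability V R) (M : R).
Hypothesis d_gt0 : (0 < d)%N.
Hypothesis M_ge0 : 0 <= M.
Hypothesis indepX : independent_RVs X.
Hypothesis lawX : forall i A, measurable A -> P (X i @^-1` A) = nu A.
Hypothesis nu_le : forall A, measurable A -> (nu A <= M%:E * lebesgue_rV A)%E.
Implicit Types (J : {set 'I_n}).

Local Notation Z := (masked_RV X 0%R [set: 'I_n]%SET).
Local Notation missZ J := (fun w => missing_mass nu J (Z w)).

Definition first_moment_constant : R := (7 * d)%:R ^+ d + (2 * d ^ 2 * 4 ^ d)%:R.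

(** For k the size of J and r = k^(-1/(d+1)) one has r^(1-d) = k r^2, so both
    terms of [integral_missing_mass_le] have the same order. *)
Lemma integral_missing_mass_le_powR J : (0 < #|J|)%N ->
  (\int[P]_w missZ J w <= (first_moment_constant * (M + 1) *
    #|J|%:R `^ (- (2 / d.+1%:R)))%:E)%E.
Proof.
move=> J0; set k : R := #|J|%:R; have k1 : 1 <= k by rewrite ler1n.
have k0 : 0 < k by rewrite ltr0n.
pose r := k `^ (- d.+1%:R^-1).
have r0 : 0 < r by rewrite powR_gt0.
have r1 : r <= 1 by rewrite -(powRr0 k) ler_powR// oppr_le0 invr_ge0.
have rX e : r ^+ e = k `^ (- (e%:R / d.+1%:R)).
  by rewrite -powR_mulrn ?powR_ge0// -powRrM mulNr mulrC.
have krd : k * (r ^+ d.-1 * r ^+ 2) = 1.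
  rewrite -exprD addn2 prednK// rX divff ?pnatr_eq0// powR_inv1 ?(ltW k0)//.
  by rewrite divff// gt_eqF.
rewrite -rX.
have := integral_missing_mass_le indepX lawX nu_le J d_gt0 _ M_ge0 (r := r).
rewrite r0 r1 -/k => /(_ isT); set I := (\int[P]_w _)%E.
set K := (7 * d)%:R ^+ d; set C := (_ * 4 ^ d)%:R => kI.
have kr : K / r ^+ d.-1 = k * (K * r ^+ 2).
  apply: (@mulIf _ (r ^+ d.-1)); first by rewrite expf_neq0// gt_eqF.
  rewrite divfK ?expf_neq0 ?gt_eqF//.
  by rewrite -[LHS]mulr1 -krd; ring.
move: kI; rewrite kr -mulrDr EFinM lee_pmul2l//.
move=> /le_trans; apply; rewrite lee_fin /first_moment_constant -/K -/C.
have K0 : 0 <= K by rewrite exprn_ge0.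
have C0 : 0 <= C by [].
have r20 : 0 <= r ^+ 2 by exact: sqr_ge0.
rewrite mulrA -mulrDl ler_wpM2r//.
have : 0 <= K * M by exact: mulr_ge0.
by lra.
Qed.

Lemma measurable_prod_missing_mass (G : nat -> {set 'I_n}) (m : nat) :
  measurable_fun setT (fun y : n.-tuple V => \prod_(j < m) missing_mass nu (G j) y)%E.
Proof.
elim: m => [|m IH].
  by under eq_fun do rewrite big_ord0; exact: measurable_cst.
under eq_fun do rewrite big_ord_recr /=.
by apply: emeasurable_funM => //; exact: measurable_missing_mass.
Qed.

(** The missing mass relative to a block is a function of that block, and
    disjoint blocks are independent. *)
Lemma integral_prod_missing_mass (G : nat -> {set 'I_n}) (m : nat) :
  (forall i j x, (i < j)%N -> x \in G i -> x \notin G j) ->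
  (\int[P]_w (\prod_(j < m) missZ (G j) w) =
   \prod_(j < m) \int[P]_w missZ (G j) w)%E.
Proof.
move=> Gdisj; elim: m => [|m IH].
  under eq_integral do rewrite big_ord0.
  rewrite big_ord0 integral_cst// mul1e; exact: probability_setT.
pose U := (\bigcup_(j < m) G j)%SET.
pose f y := (\prod_(j < m) missing_mass nu (G j) y)%E.
have f0 y : (0 <= f y)%E by apply: prode_ge0 => i _; exact: measure_ge0.
have mf : measurable_fun setT f := measurable_prod_missing_mass G m.
have missE J J' w : J \subset J' ->
    missing_mass nu J (masked_RV X 0%R J' w) = missZ J w.
  move=> JJ'; congr (nu _); apply: ysection_masked JJ'.
  exact: depends_on_cube_beyond.
have fE w : f (Z w) = f (masked_RV X 0%R U w).
  apply: eq_bigr => j _; rewrite missE//.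
  by apply: finset.bigcup_sup.
have UG x : x \in U -> x \notin G m.
  by move=> /finset.bigcupP[j _]; exact: Gdisj.
have indep A B : measurable A -> measurable B ->
    P (masked_RV X 0%R U @^-1` A `&` masked_RV X 0%R (G m) @^-1` B) =
    (P (masked_RV X 0%R U @^-1` A) * P (masked_RV X 0%R (G m) @^-1` B))%E.
  exact: (masked_independent _ indepX UG).
transitivity (\int[P]_w
    (f (masked_RV X 0%R U w) * missing_mass nu (G m) (masked_RV X 0%R (G m) w)))%E.
  apply: eq_integral => w _; rewrite big_ord_recr /=; congr (_ * _)%E.
    exact: fE.
  exact/esym/missE.
have miss0 y : (0 <= missing_mass nu (G m) y)%E by exact: measure_ge0.
have := integral_mul_independent indep mf (measurable_missing_mass nu (G m)) f0 miss0.
move=> ->; rewrite big_ord_recr /= -IH; congr (_ * _)%E; apply: eq_integral => w _.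
  exact/esym/fE.
exact: missE.
Qed.

End moments.

(** * From the missing volume to the missing mass *)

(** Monotonicity for arbitrary, possibly nonmeasurable, functions: the simple
    functions below f are among those below g. *)
Lemma ge0_le_lower_integral (disp : measure_display) (T : measurableType disp)
    (R : realType) (mu : {measure set T -> \bar R}) (f g : T -> \bar R) :
  (forall x, 0 <= f x)%E -> (forall x, f x <= g x)%E ->
  (\int[mu]_x f x <= \int[mu]_x g x)%E.
Proof.
move=> f0 fg; have g0 x : (0 <= g x)%E by exact: le_trans (fg x).
rewrite !ge0_integralTE//; apply: ereal_sup_le => _ [h hf <-]; exists h => //.
by move=> x; exact: le_trans (fg x).
Qed.

(** The first term serves for t <= a and the second one for t > a. This
    replaces an appeal to the monotonicity of L^p norms. *)
Lemma powR_le_moment (R : realType) (q a t : R) (m : nat) : 0 <= q <= m%:R ->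
  0 < a -> 0 <= t -> t `^ q <= a `^ q * (1 + a ^- m * t ^+ m).
Proof.
move=> /andP[q0 qm] a0 t0.
have tm : 0 <= a ^- m * t ^+ m by rewrite mulr_ge0 ?invr_ge0 ?exprn_ge0// ltW.
have [ta|at_] := leP t a.
  apply: (@le_trans _ _ (a `^ q)); first by rewrite ge0_ler_powR ?nnegrE ?(ltW a0).
  by rewrite ler_peMr ?powR_ge0// lerDl.
have -> : t = a * (t / a) by rewrite mulrC divfK// gt_eqF.
have ta1 : 1 <= t / a by rewrite ler_pdivlMr// mul1r ltW.
rewrite powRM ?(ltW a0) ?(le_trans _ ta1)// ler_wpM2l ?powR_ge0//.
rewrite (le_trans (ler_powR ta1 qm))// powR_mulrn ?(le_trans _ ta1)//.
rewrite [X in _ + _ * X]exprMn mulrA mulVf ?mul1r ?lerDr//.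
by rewrite expf_neq0// gt_eqF.
Qed.

Section density.
Context (R : realType) (d n : nat) (disp : measure_display)
  (T : measurableType disp) (P : probability T R).
Local Notation V := 'rV[R]_d.
Variables (X : 'I_n -> {RV P >-> V}) (nu : probability V R)
  (f : V -> R) (M : R) (K : set V).
Hypothesis density_f : probability_density f.
Hypothesis nuE : forall A, measurable A ->
  nu A = (\int[@lebesgue_rV R d]_(x in A) (f x)%:E)%E.

Lemma density_le : 0 <= M -> {ae @lebesgue_rV R d, forall x, f x <= M} ->
  forall A, measurable A -> (nu A <= M%:E * lebesgue_rV A)%E.
Proof.
have [mf f0 _] := density_f.
move=> M0 fM A mA; rewrite nuE// -integral_cst//; apply: ae_ge0_le_integral => //.
- by move=> x _; rewrite lee_fin.
- by apply: measurable_funTS; exact/measurable_EFinP.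
by apply: filterS fM => x fx _; rewrite lee_fin.
Qed.

(** Points of K outside the hull are separated from the sample by a rational
    direction, and they lie in the cube since K lies in the unit ball. *)
Lemma weighted_missing_volume_bounds w : (0 < n)%N -> K `<=` @unit_ball R d ->
  ((weighted_missing_volume f K (convex_hull (range (fun i => X i w))))%:E <=
    missing_mass nu [set: 'I_n]%SET (masked_RV X 0%R [set: 'I_n]%SET w))%E /\
  0 <= weighted_missing_volume f K (convex_hull (range (fun i => X i w))).
Proof.
move=> n0 K1; have [mf f0 _] := density_f.
set y := masked_RV _ _ _ _.
pose D := K `\` convex_hull (range (fun i => X i w)).
pose I := (\int[@lebesgue_rV R d]_(x in D) (f x)%:E)%E.
have I0 : (0 <= I)%E by apply: integral_ge0 => x _; rewrite lee_fin.
have Ile : (I <= missing_mass nu [set: 'I_n]%SET y)%E.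
  rewrite /missing_mass nuE; last by apply: measurable_ysection; exact: measurable_cube_beyond.
  rewrite /I integral_mkcond [leRHS]integral_mkcond; apply: ge0_le_lower_integral => x.
    by rewrite patchE; case: ifP => // _; rewrite lee_fin.
  rewrite !patchE; case: ifPn => [|_]; last by case: ifP => // _; rewrite lee_fin.
  rewrite inE => -[/K1 x1 xNhull]; rewrite ifT// inE /ysection /= inE; split=> [c|].
    rewrite -(@ler_sqr _ _ 1) ?nnegrE// expr1n real_normK ?num_real//.
    move: x1; rewrite /unit_ball /= /euclidean_norm -[X in _ <= X -> _]sqrtr1.
    rewrite ler_sqrt// => x1; apply: le_trans x1.
    by rewrite (bigD1 c)//= lerDl sumr_ge0// => i _; rewrite sqr_ge0.
  have [q q0 qx] := exists_separating_rational_vector n0 xNhull.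
  by exists q => // j _ /=; rewrite mul0r /y tnth_masked ?inE.
have Ifin : I \is a fin_num.
  rewrite ge0_fin_numE// (le_lt_trans Ile)// (@le_lt_trans _ _ 1%E) ?ltry//.
  by apply: probability_le1; apply: measurable_ysection; exact: measurable_cube_beyond.
rewrite /weighted_missing_volume /Rintegral -/I fineK//; split=> //.
exact: fine_ge0.
Qed.

End density.

(** * The moment bound *)

Lemma le_expr_prode (R : realType) (t : R) (m : nat) (g : 'I_m -> \bar R) :
  0 <= t -> (forall j, t%:E <= g j)%E -> ((t ^+ m)%:E <= \prod_(j < m) g j)%E.
Proof.
move=> t0; elim: m => [|m IH] in g * => tg; first by rewrite big_ord0 expr0.
rewrite big_ord_recr /= exprSr EFinM; apply: lee_pmul => //.
- by rewrite lee_fin exprn_ge0.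
exact: IH.
Qed.

Lemma prode_le_expr (R : realType) (a : R) (m : nat) (g : 'I_m -> \bar R) :
  (forall j, 0 <= g j)%E -> (forall j, g j <= a%:E)%E ->
  (\prod_(j < m) g j <= (a ^+ m)%:E)%E.
Proof.
move=> g0; elim: m => [|m IH] in g g0 * => ga; first by rewrite big_ord0 expr0.
rewrite big_ord_recr /= exprSr EFinM; apply: lee_pmul => //.
- exact: prode_ge0.
exact: IH.
Qed.

(** The blocks j k, ..., j k + k - 1 are the classes of equal quotient by k. *)
Lemma card_block (n m k j : nat) : (m * k <= n)%N -> (j < m)%N ->
  (k <= #|[set i : 'I_n | i %/ k == j]%SET|)%N.
Proof.
move=> mkn jm.
have lt (a : 'I_k) : (j * k + a < n)%N.
  apply: leq_trans mkn; apply: (@leq_trans (j * k + k)); first by rewrite ltn_add2l.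
  by rewrite -mulSnr leq_mul2r jm orbT.
have inj : injective (fun a => Ordinal (lt a)).
  by move=> a b /(congr1 val) /= /addnI /val_inj.
rewrite -[leqLHS]card_ord -(card_imset _ inj); apply: subset_leq_card.
apply/fintype.subsetP => _ /imsetP[a _ ->]; rewrite inE /=.
have k0 : (0 < k)%N by apply: leq_ltn_trans (ltn_ord a).
by rewrite divnMDl// divn_small// addn0.
Qed.

Theorem corollary1 (R : realType) (d : nat) (hd : (2 <= d)%N)
    (q : R) (hq : 0 < q) :
  exists2 A : R, 0 < A &
    forall (n : nat) (K : set 'rV[R]_d) (f : 'rV[R]_d -> R) (M : R)
      (disp : measure_display) (T : measurableType disp) (P : probability T R)
      (X : 'I_n -> {RV P >-> 'rV[R]_d}),
      (1 <= n)%N ->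
      convex_body K ->
      K `<=` @unit_ball R d ->
      probability_density f ->
      (forall x, ~ K x -> f x = 0) ->
      0 < M ->
      {ae @lebesgue_rV R d, forall x, f x <= M} ->
      independent_RVs X ->
      (forall i, has_density (X i) f) ->
      ('E_P[fun w => (weighted_missing_volume f K
                (convex_hull (range (fun i => X i w))) `^ q)%R]
       <= (A * (M + 1) `^ q * n%:R `^ (- (2 * q / d.+1%:R)))%:E)%E.
Proof.
have d0 : (0 < d)%N by exact: ltnW.
pose m := (Num.trunc q).+1.
have qm : 0 <= q <= m%:R.
  by rewrite (ltW hq) /=; have /andP[_ /ltW] := truncn_itv (ltW hq).
pose s := 2 * q / d.+1%:R; pose t : R := 2 / d.+1%:R.
have s0 : 0 <= s by rewrite divr_ge0// mulr_ge0// ltW.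
pose C := first_moment_constant R d.
have C0 : 0 < C by rewrite ltr_pwDl// exprn_gt0// ltr0n muln_gt0.
have m2_gt0 : 0 < (2 * m)%:R :> R by rewrite ltr0n.
exists ((1 + 2 * C `^ q) * (2 * m)%:R `^ s) => [|n K f M disp T P X n1 _ K1 ff _ M0 fM].
  by rewrite mulr_gt0 ?powR_gt0// ltr_pwDl// mulr_ge0 ?powR_ge0.
move=> indepX densX; rewrite -/s.
pose nu : probability 'rV[R]_d R := distribution P (X (Ordinal n1)).
have nuE A : measurable A -> nu A = (\int[@lebesgue_rV R d]_(x in A) (f x)%:E)%E.
  exact: densX.
have lawX i A : measurable A -> P (X i @^-1` A) = nu A.
  by move=> mA; rewrite nuE//; exact: densX.
have nu_le := density_le ff nuE (ltW M0) fM.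
pose Z := masked_RV X 0 [set: 'I_n]%SET.
pose p w := weighted_missing_volume f K (convex_hull (range (fun i => X i w))).
have pP w := weighted_missing_volume_bounds X ff nuE w n1 K1.
have p0 w : 0 <= p w by exact: (pP w).2.
have p_miss J w : ((p w)%:E <= missing_mass nu J (Z w))%E.
  apply: (le_trans (pP w).1).
  by apply: missing_mass_subset; exact: finset.subsetT.
have M1 : 1 <= M + 1 by rewrite lerDr ltW.
have M1q : 1 <= (M + 1) `^ q by rewrite -[leLHS](powRr0 (M + 1)) ler_powR// ltW.
have n_gt0 : 0 < n%:R :> R by rewrite ltr0n.
(* For n < m there is no room for m groups, but then p <= 1 suffices. *)
rewrite unlock; have [nm|mn] := ltnP n m.
  apply: (@le_trans _ _ (\int[P]_w 1)%E).
    apply: ge0_le_lower_integral => w; rewrite lee_fin ?powR_ge0//.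
    apply: (@le_trans _ _ (1 `^ q)); last by rewrite powR1.
    rewrite ge0_ler_powR ?nnegrE ?(ltW hq)//; first exact: (p0 w).
    rewrite -lee_fin; apply: (le_trans (p_miss [set: 'I_n]%SET w)).
    apply: probability_le1.
    by apply: measurable_ysection; exact: measurable_cube_beyond.
  rewrite integral_cst// mul1e [leLHS](_ : _ = 1%E); last exact: probability_setT.
  rewrite lee_fin.
  rewrite powRN ler_pdivlMr ?powR_gt0// mul1r.
  apply: (@le_trans _ _ (1 * (2 * m)%:R `^ s * 1)).
    rewrite mul1r mulr1 ge0_ler_powR ?nnegrE// ler_nat.
    by rewrite (leq_trans (ltnW nm))// leq_pmull.
  rewrite ler_pM ?ler_wpM2r ?mulr_ge0 ?powR_ge0// lerDl.
  by rewrite mulr_ge0 ?powR_ge0.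
pose k := (n %/ m)%N.
have k_gt0 : (0 < k)%N by rewrite divn_gt0.
have kR : 0 < k%:R :> R by rewrite ltr0n.
pose G (j : nat) : {set 'I_n} := [set i : 'I_n | (i %/ k)%N == j]%SET.
have Gdisj i j x : (i < j)%N -> x \in G i -> x \notin G j.
  by rewrite !inE => ij /eqP ->; rewrite neq_ltn ij.
have cardG j : (j < m)%N -> (k <= #|G j|)%N.
  by apply: card_block; rewrite mulnC leq_divM.
pose a := C * (M + 1) * k%:R `^ (- t).
have a0 : 0 < a by rewrite !mulr_gt0 ?powR_gt0// (lt_le_trans _ M1).
have Ga (j : 'I_m) : (\int[P]_w missing_mass nu (G j) (Z w) <= a%:E)%E.
  have Gj := cardG _ (ltn_ord j).
  apply: le_trans (integral_missing_mass_le_powR d0 (ltW M0) indepX lawX nu_le _) _.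
    exact: leq_trans Gj.
  rewrite lee_fin ler_wpM2l ?mulr_ge0 ?(ltW C0) ?(le_trans _ M1)//.
  rewrite !powRN lef_pV2 ?posrE ?powR_gt0 ?ltr0n ?(leq_trans _ Gj)//.
  by rewrite ge0_ler_powR ?nnegrE ?divr_ge0 ?ler_nat.
pose F w := (\prod_(j < m) missing_mass nu (G j) (Z w))%E.
have F0 w : (0 <= F w)%E by apply: prode_ge0 => j _; exact: measure_ge0.
have mF : measurable_fun setT F.
  exact: (measurableT_comp (measurable_prod_missing_mass nu G m)).
have IF : (\int[P]_w F w <= (a ^+ m)%:E)%E.
  rewrite (integral_prod_missing_mass nu indepX m Gdisj); apply: prode_le_expr => // j.
  by apply: integral_ge0 => w _; exact: measure_ge0.
apply: (@le_trans _ _ (\int[P]_w ((a `^ q)%:E * (1 + (a ^- m)%:E * F w)))%E).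
  apply: ge0_le_lower_integral => w; first by rewrite lee_fin powR_ge0.
  apply: (@le_trans _ _ (a `^ q * (1 + a ^- m * p w ^+ m))%:E).
    by rewrite lee_fin; exact: (powR_le_moment qm a0 (p0 w)).
  rewrite EFinM lee_wpmul2l ?lee_fin ?powR_ge0// EFinD leeD2l// EFinM.
  by rewrite lee_wpmul2l ?lee_fin ?invr_ge0 ?exprn_ge0 ?(ltW a0)// le_expr_prode.
have am0 : 0 <= a ^- m by rewrite invr_ge0 exprn_ge0// ltW.
apply: (@le_trans _ _ (a `^ q * (1 + 1))%:E).
  rewrite ge0_integralZl//; last 3 first.
  - by apply: emeasurable_funD => //; exact: measurable_funeM.
  - by move=> w _; rewrite adde_ge0// mule_ge0.
  - by rewrite lee_fin powR_ge0.
  rewrite ge0_integralD//; last 2 first.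
  - by move=> w _; rewrite mule_ge0.
  - exact: measurable_funeM.
  rewrite integral_cst// mul1e.
  rewrite [X in (X + _)%E](_ : _ = 1%E); last exact: probability_setT.
  rewrite ge0_integralZl//.
  rewrite EFinM lee_wpmul2l ?lee_fin ?powR_ge0// EFinD leeD2l//.
  apply: (le_trans (lee_wpmul2l _ IF)); first by rewrite lee_fin.
  by rewrite -EFinM mulVf// expf_neq0// gt_eqF.
rewrite lee_fin.
have aq : a `^ q = C `^ q * (M + 1) `^ q * k%:R `^ (- s).
  rewrite !powRM ?mulr_ge0 ?powR_ge0 ?(ltW C0) ?(le_trans _ M1)//.
  by rewrite -powRrM mulNr (_ : t * q = s) // /t /s mulrAC.
(* The size k of the groups is at least n / (2 m). *)
have ks : k%:R `^ (- s) <= (2 * m)%:R `^ s * n%:R `^ (- s).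
  rewrite !powRN ler_pdivlMr ?powR_gt0// mulrC ler_pdivrMr ?powR_gt0//.
  rewrite -powRM// (ge0_ler_powR s0) ?nnegrE ?mulr_ge0// -natrM ler_nat.
  rewrite {1}(divn_eq n m) -/k.
  rewrite (_ : (2 * m * k = k * m + k * m)%N).
    by rewrite leq_add2l ltnW// (leq_trans (ltn_pmod n _))// leq_pmull.
  by rewrite -mulnA mul2n -addnn mulnC.
rewrite aq -mulrA mulrC.
apply: (@le_trans _ _
  (2 * C `^ q * ((2 * m)%:R `^ s * n%:R `^ (- s)) * (M + 1) `^ q)).
  rewrite [leLHS](_ : _ = 2 * C `^ q * k%:R `^ (- s) * (M + 1) `^ q); last by ring.
  by rewrite ler_wpM2r ?powR_ge0// ler_wpM2l// mulr_ge0 ?powR_ge0.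
rewrite [leLHS](_ : _ =
  2 * C `^ q * ((2 * m)%:R `^ s * (M + 1) `^ q * n%:R `^ (- s))); last by ring.
rewrite -!mulrA [leRHS]mulrDl mul1r -!mulrA lerDr.
by rewrite !mulr_ge0 ?powR_ge0.
Qed.
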